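(* Let $K>0$, let $G\in\mathbf{RH}_\infty$ (scalar), and let $\phi:\mathbb{R}\to\mathbb{R}$ be a memoryless nonlinearity with $\phi(0)=0$ that is slope-restricted in $S[0,K]$. Let $n\ge 0$ be an integer, let $\Psi(z)$ be the $(2n+2)\times 2$ transfer matrix given in the context, and let $$\Psi(z)\begin{bmatrix}-G(z)\\ 1\end{bmatrix}$$ have state-space description $(\hat A,\hat B,\hat C,\hat D)$. Suppose there exist a matrix $X=X^\top$ and a real vector $$m^\top=\begin{bmatrix}m_{-n}&\cdots&m_{-1}&1&m_1&\cdots&m_n\end{bmatrix}$$ (so $m_0=1$) such that $$\begin{bmatrix}\hat A^\top X\hat A-X&\hat A^\top X\hat B\\ \hat B^\top X\hat A&\hat B^\top X\hat B\end{bmatrix}+\begin{bmatrix}\hat C&\hat D\end{bmatrix}^\top\kappa(K,m)\begin{bmatrix}\hat C&\hat D\end{bmatrix}<0,$$ where $\kappa(K,m)$ is the symmetric matrix given in the context, and $$\sum_{i=-n}^{n}|m_i|<2,$$ and either $m_i\le 0$ for all $i\ne 0$ or $\phi$ is odd. Then the feedback interconnection $v_j=f_j+(Gw)_j$, $w_j=-\phi(v_j)+g_j$ ($j\in\mathbb{Z}_+$) is $\ell_2$-stable.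
   Context: Notation. $\mathbb{Z}_+$ is the set of nonnegative integers; $\ell$ is the space of real sequences on $\mathbb{Z}_+$ and $\ell_2\subset\ell$ the square-summable ones. $\mathbf{RH}_\infty$ is the space of real rational transfer functions with all poles strictly inside the unit circle; $G$ acts on $\ell$ as the corresponding causal LTI operator (zero initial state). A state-space description $(A,B,C,D)$ of a transfer matrix $H$ means $H(z)=C(zI-A)^{-1}B+D$, $z$ denoting the forward shift. $\phi$ is slope-restricted in $S[0,K]$ if $0\le \frac{\phi(x_1)-\phi(x_2)}{x_1-x_2}\le K$ for all real $x_1\ne x_2$; $\phi$ is odd if $\phi(-x)=-\phi(x)$ for all $x$. The feedback interconnection is well-posed if the map $(v,w)\mapsto(g,f)$ has a causal inverse on $\ell\times\ell$; it is $\ell_2$-stable if for any $f,g\in\ell_2$ both $v,w\in\ell_2$. For symmetric matrices, $<0$ means negative definite. Matrices. Put $\psi(z)=\begin{bmatrix}1&z^{-1}&z^{-2}&\cdots&z^{-n}\end{bmatrix}^\top$ and $$\Psi(z)=\begin{bmatrix}\psi(z)&0\\ 0&\psi(z)\end{bmatrix}.$$ The $(2n+2)\times(2n+2)$ matrix $\kappa(K,m)$ is $$\kappa(K,m)=\begin{bmatrix}0&R\\ R^\top&S\end{bmatrix},$$ with $(n+1)\times(n+1)$ blocks $$R=\begin{bmatrix}K m_0&K m_1&K m_2&\cdots&K m_n\\ K m_{-1}&0&0&\cdots&0\\ K m_{-2}&0&0&\cdots&0\\ \vdots&\vdots&\vdots&&\vdots\\ K m_{-n}&0&0&\cdots&0\end{bmatrix},$$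 $$S=\begin{bmatrix}-2m_0&-m_1-m_{-1}&-m_2-m_{-2}&\cdots&-m_n-m_{-n}\\ -m_1-m_{-1}&0&0&\cdots&0\\ -m_2-m_{-2}&0&0&\cdots&0\\ \vdots&\vdots&\vdots&&\vdots\\ -m_n-m_{-n}&0&0&\cdots&0\end{bmatrix},$$ where $m_0=1$. *)

(* Defs.v *)
From HB Require Import structures.
From mathcomp Require Import all_boot all_order all_algebra.
From mathcomp Require Import generic_quotient fraction complex.
From mathcomp Require Import all_classical all_reals all_analysis.

Set Implicit Arguments.
Unset Strict Implicit.
Unset Printing Implicit Defensive.

Import Order.TTheory GRing.Theory Num.Theory.
Import numFieldNormedType.Exports.

Local Open Scope ring_scope.
Local Open Scope complex_scope.

(* The field R(z); the indeterminate z is the forward shift. *)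
Notation tf R := {fraction {poly R}} (only parsing).

Section TransferFunctions.
Variable R : realType.

Definition tf_poly (p : {poly R}) : tf R := @FracField.tofrac {poly R} p.

Definition tf_const (c : R) : tf R := tf_poly c%:P.

Definition tf_z : tf R := tf_poly 'X.

(* G = tf_num G / tf_den G in lowest terms; the poles of G at finite points
   are the complex roots of tf_den G. *)
Definition tf_num (G : tf R) : {poly R} :=
  let r := repr G in (frac r).1 %/ gcdp (frac r).1 (frac r).2.

Definition tf_den (G : tf R) : {poly R} :=
  let r := repr G in (frac r).2 %/ gcdp (frac r).1 (frac r).2.

(* The degree condition excludes a pole at infinity, that is, G is proper. *)
Definition RHinf (G : tf R) : Prop :=
  (size (tf_num G) <= size (tf_den G))%N /\
  forall z : R[i], root (map_poly (real_complex R) (tf_den G)) z -> `|z| < 1.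

(* For proper G = h_0 + h_1 z^-1 + h_2 z^-2 + ..., the polynomial part of
   z^k G is h_0 z^k + ... + h_k, so Euclidean division extracts h_k. *)
Definition impulse (G : tf R) (k : nat) : R :=
  ((tf_num G * 'X^k) %/ tf_den G)`_0.

Definition lti (G : tf R) (w : nat -> R) (j : nat) : R :=
  \sum_(i < j.+1) impulse G i * w (j - i)%N.

Definition ss_tf (p q N : nat) (A : 'M[R]_N) (B : 'M[R]_(N, q))
    (C : 'M[R]_(p, N)) (D : 'M[R]_(p, q)) : 'M[tf R]_(p, q) :=
  map_mx tf_const C *m invmx (tf_z%:M - map_mx tf_const A)
    *m map_mx tf_const B + map_mx tf_const D.

Definition state_space (p q N : nat) (H : 'M[tf R]_(p, q)) (A : 'M[R]_N)
    (B : 'M[R]_(N, q)) (C : 'M[R]_(p, N)) (D : 'M[R]_(p, q)) : Prop :=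
  H = ss_tf A B C D.

Definition psi (n : nat) : 'cV[tf R]_n.+1 := \col_i tf_z ^- i.

Definition Psi (n : nat) : 'M[tf R]_(n.+1 + n.+1, 1 + 1) :=
  block_mx (psi n) 0 0 (psi n).

End TransferFunctions.

Section Multiplier.
Variable R : realType.

(* The vector (m_{-n}, ..., m_n) is stored from position 0, so that the
   coefficient m_i sits at position n + i; meaningful for -n <= i <= n. *)
Definition mcoef (n : nat) (m : 'cV[R]_(n.*2.+1)) (i : int) : R :=
  m (inord (absz (n%:Z + i))) 0.

Definition kappaR (n : nat) (K : R) (m : 'cV[R]_(n.*2.+1)) : 'M[R]_n.+1 :=
  \matrix_(i, j)
    if i == 0 :> nat then K * mcoef m j%:Z
    else if j == 0 :> nat then K * mcoef m (- i%:Z) else 0.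

(* At (0, 0) the general formula gives - m_0 - m_0 = - 2 m_0. *)
Definition kappaS (n : nat) (m : 'cV[R]_(n.*2.+1)) : 'M[R]_n.+1 :=
  \matrix_(i, j)
    if i == 0 :> nat then - mcoef m j%:Z - mcoef m (- j%:Z)
    else if j == 0 :> nat then - mcoef m i%:Z - mcoef m (- i%:Z) else 0.

Definition kappa (n : nat) (K : R) (m : 'cV[R]_(n.*2.+1))
    : 'M[R]_(n.+1 + n.+1) :=
  block_mx 0 (kappaR K m) (kappaR K m)^T (kappaS m).

Definition neg_def (k : nat) (P : 'M[R]_k) : Prop :=
  forall x : 'cV[R]_k, x != 0 -> (x^T *m P *m x) 0 0 < 0.

End Multiplier.

Section Feedback.
Variable R : realType.

Definition slope_restricted (K : R) (phi : R -> R) : Prop :=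
  forall x1 x2 : R, x1 != x2 -> 0 <= (phi x1 - phi x2) / (x1 - x2) <= K.

Definition odd_fun (phi : R -> R) : Prop := forall x : R, phi (- x) = - phi x.

Definition ell2 (u : nat -> R) : Prop :=
  cvgn (series (fun j : nat => u j ^+ 2)).

Definition feedback (G : tf R) (phi : R -> R) (f g v w : nat -> R) : Prop :=
  forall j : nat, v j = f j + lti G w j /\ w j = - phi (v j) + g j.

(* Speaking of "the" responses v, w to inputs f, g presupposes that they
   exist; requiring it keeps the definition from holding vacuously. *)
Definition ell2_stable (G : tf R) (phi : R -> R) : Prop :=
  forall f g : nat -> R, ell2 f -> ell2 g ->
    (exists v w : nat -> R, feedback G phi f g v w) /\
    (forall v w : nat -> R, feedback G phi f g v w -> ell2 v /\ ell2 w).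

End Feedback.

(* Main.v *)
Require Import Defs.
From HB Require Import structures.
From mathcomp Require Import all_boot all_order all_algebra.
From mathcomp Require Import cyclic separable cyclotomic.
From mathcomp Require Import generic_quotient fraction complex.
From mathcomp Require Import perm ring lra zify.
From mathcomp Require Import all_classical all_reals all_analysis.

Set Implicit Arguments.
Unset Strict Implicit.
Unset Printing Implicit Defensive.

Import Order.TTheory GRing.Theory Num.Theory.
Import numFieldNormedType.Exports.

Local Open Scope ring_scope.

(** Write [w_T] for the truncation of a signal [w] to [[0, T)], [|w|_T] for its
    energy over [[0, T)], and [<a, b>_m = \sum_i m_i \sum_t a_t b_(t+i)] for the
    form attached to the multiplier.  Two inequalities about this form are
    played against each other.

    The nonlinearity contributes the Zames-Falb inequality ([zames_falb]): for
    [u = phi v] and [e = K v - u] the samples of [u] and [e] are similarly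
    ordered, because the slope of [phi] lies in [[0, K]].  By the rearrangement
    inequality no shift of [e] correlates better with [u] than [e] itself, and
    since the coefficients other than [m_0 = 1] have total weight less than 1,
    [<u, e>_m >= 0].  The truncated signals already satisfy this.

    The matrix inequality contributes the opposite bound
    [eps |w|_T <= <w_T, w_T + K G w_T>_m] ([time_domain_inequality]).  It is
    obtained in the frequency domain: at a point [z] of the unit circle that is
    no eigenvalue of [A], the state [(z - A)^-1 B] inserted in the quadratic
    form of the matrix inequality makes the terms in [X] cancel, whatever the
    sign of [X] and whether or not [A] is stable, and leaves
    [Re (M (1 + K G)) >= 2 eps] with [M z = \sum_i m_i z^i]
    ([frequency_inequality]).  Since [G] is stable it is uniformly close on the
    circle to a finite section of its impulse response ([tf_series_approx]), so
    that summing over sufficiently many twisted roots of unity, chosen away from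
    the eigenvalues of [A], turns this into a statement about finite signals.

    Along a solution of the loop both inequalities involve the same signals, up
    to the inputs and to the response of [G] to [w_T] after time [T], which the
    form only sees through the last [n] samples of [w_T].  The outcome is
    [|w|_T <= c (|f|_T + |g|_T) + c (|w|_T - |w|_(T-n))] ([energy_estimate]).
    If [|w|_T] is known to be bounded, some later window makes the last term as
    small as desired, and [|w|_T <= c (|f|_T + |g|_T)] follows with the same [c]
    ([bounded_estimate]).  To supply the boundedness, the sector is deformed:
    nonlinearities of slope in [[0, kappa]] are treated for [kappa] growing from
    0 to [K].  As [c] does not depend on [kappa], a small-gain argument increases
    [kappa] by steps of a fixed length ([sector_step]).

    Existence of solutions needs [1 + kappa G(oo) > 0], which makes the
    instantaneous loop equation uniquely solvable.  This is carried along the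
    same deformation: the class contains the linear gain [kappa], for which
    the first sample of the response to a unit pulse is
    [1 / (1 + kappa G(oo))], so the uniform bound [c] keeps the denominator away
    from 0 ([well_posed_margin]). *)

(** * The Zames-Falb inequality on a finite horizon *)

(** A permutation is undone one point at a time: the index where [u + e] is
    largest among the displaced ones maximizes both [u] and [e] there, and
    making it a fixed point does not decrease the sum. *)
Lemma rearrangement (R : realFieldType) (T : finType) (u e : T -> R)
    (s : {perm T}) :
  (forall i j, 0 <= (u i - u j) * (e i - e j)) ->
  \sum_i u i * e (s i) <= \sum_i u i * e i.
Proof.
move=> ue_mono.
have max_le i j : u j + e j <= u i + e i -> u j <= u i /\ e j <= e i.
  move=> le_ij; have := ue_mono i j => h.
  by split; rewrite leNgt; apply/negP => lt_ij; nra.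
have [k] := ubnP #|[set i | s i != i]|.
elim: k s => // k IHk s; rewrite ltnS => sk.
have [x sx|s1] := pickP [pred i | s i != i]; last first.
  rewrite le_eqVlt; apply/orP; left; apply/eqP/eq_bigr => i _.
  by have /= /negbFE/eqP -> := s1 i.
have [i0 /= si0 i0max] := @arg_maxP _ _ T x (fun i => s i != i) (fun i => u i + e i) sx.
have [a sa] : exists a, s a = i0 by exists ((s^-1)%g i0); rewrite permKV.
pose b := s i0.
have ai0 : a != i0 by apply: contraNneq si0 => ai; rewrite -{1}ai sa.
have sb : s b != b by apply: contraNneq si0 => /perm_inj/eqP.
have [uai0 _] : u a <= u i0 /\ e a <= e i0.
  by apply/max_le/i0max; rewrite sa eq_sym.
have [_ ebi0] : u b <= u i0 /\ e b <= e i0 by apply/max_le/i0max.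
pose s' := (s * tperm i0 b)%g.
have s'i0 : s' i0 = i0 by rewrite permM tpermR.
have s'a : s' a = b by rewrite permM sa tpermL.
have s'E i : i != i0 -> i != a -> s' i = s i.
  move=> ii0 ia; rewrite permM tpermD //; last by rewrite (inj_eq perm_inj) eq_sym.
  by apply: contraNneq ia => si; apply/eqP/(@perm_inj _ s); rewrite sa.
apply: le_trans (IHk s' _).
  rewrite (bigD1 i0) //= (bigD1 a) //= [leRHS](bigD1 i0) //= [in leRHS](bigD1 a) //=.
  rewrite s'i0 s'a sa -/b.
  rewrite [in leRHS](eq_bigr (fun i => u i * e (s i))); last first.
    by move=> i /andP[ii0 ia]; rewrite s'E.
  set S := \sum_(i | _) _.
  have : 0 <= (u i0 - u a) * (e i0 - e b) by rewrite mulr_ge0 ?subr_ge0.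
  by lra.
apply: leq_trans sk; apply: proper_card; apply/fintype.properP; split.
  apply/fintype.subsetP => i; rewrite !inE; apply: contraNN => /eqP si.
  rewrite s'E ?si //; first by apply: contraNneq si0 => <-; rewrite si.
  by apply: contraNneq sb => ia; rewrite /b -sa -ia !si.
by exists i0; rewrite !inE ?s'i0 ?eqxx.
Qed.

(** The rearrangement inequality on two copies of the index set, carrying
    [(u, e)] and [(- u, - e)], for the permutation that also swaps the copies. *)
Lemma rearrangement_opp (R : realFieldType) (T : finType) (u e : T -> R)
    (s : {perm T}) :
  (forall i j, 0 <= (u i - u j) * (e i - e j)) ->
  (forall i j, 0 <= (u i + u j) * (e i + e j)) ->
  - \sum_i u i * e (s i) <= \sum_i u i * e i.
Proof.
move=> ue_mono ue_odd.
(* the boolean selects the copy through its sign *)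
pose U (i : T * bool) := (-1) ^+ i.2 * u i.1.
pose E (i : T * bool) := (-1) ^+ i.2 * e i.1.
pose f (i : T * bool) := (s i.1, ~~ i.2).
have f_inj : injective f by case=> [i []] [j []] [] /perm_inj ->.
have pairE (F : T * bool -> R) : \sum_i F i = \sum_i (F (i, true) + F (i, false)).
  rewrite (eq_bigr (fun i => F (i.1, i.2))); last by case.
  rewrite -(pair_bigA _ (fun i b => F (i, b))) /=.
  by apply: eq_bigr => i _; rewrite big_bool.
have sumE (g : T -> R) : \sum_i (g i + g i) = (\sum_i g i) *+ 2.
  by rewrite big_split /= mulr2n.
have LE : \sum_i U i * E (perm f_inj i) = (- \sum_i u i * e (s i)) *+ 2.
  rewrite pairE -sumrN -sumE; apply: eq_bigr => i _.
  by rewrite !permE /U /E /= !expr1 !expr0 !mulN1r !mul1r mulNr mulrN.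
have RE : \sum_i U i * E i = (\sum_i u i * e i) *+ 2.
  rewrite pairE -sumE; apply: eq_bigr => i _.
  by rewrite /U /E /= !expr1 !expr0 !mulN1r !mul1r mulrNN.
have := @rearrangement _ _ U E (perm f_inj).
rewrite LE RE lerMn2r /=; apply.
case=> [i []] [j []]; rewrite /U /E /= ?expr1 ?expr0 ?mulN1r ?mul1r ?opprK.
- by have := ue_mono j i; rewrite ![- _ + _]addrC.
- by have := ue_odd i j; rewrite -!opprD mulrNN.
- exact: ue_odd.
- exact: ue_mono.
Qed.

Section Correlation.
Variable R : realType.
Implicit Types (a b u v w : nat -> R) (n T i : nat).

Definition trunc T a : nat -> R := fun t => if (t < T)%N then a t else 0.

(** The multiplier coefficient stored at position [i] is the one of the shift
    by [i - n]; signals vanish at negative times. *)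
Definition tshift n i b : nat -> R :=
  fun t => if (n <= t + i)%N then b (t + i - n)%N else 0.

Definition shift_form n (m : 'cV[R]_(n.*2.+1)) T a b : R :=
  \sum_i m i 0 * \sum_(t < T) a t * tshift n i b t.

(** Truncated signals vanish on the last [n] points of [[0, T + n)], so there a
    shift by at most [n] agrees with a cyclic shift, which is a permutation. *)
Lemma shift_perm n i T (i_le : (i <= n.*2)%N) :
  exists Q (s : {perm 'I_Q}), forall u e,
    \sum_(t < Q) trunc T u t * trunc T e t = \sum_(t < T) u t * e t /\
    \sum_(t < Q) trunc T u t * trunc T e (s t)
      = \sum_(t < T) u t * tshift n i (trunc T e) t.
Proof.
have [->|T_gt0] := posnP T; first by exists 0, 1%g => u e; rewrite !big_ord0.
pose Q := (T + n)%N.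
have Q_gt0 : (0 < Q)%N by rewrite addn_gt0 T_gt0.
pose p (t : 'I_Q) : 'I_Q := Ordinal (ltn_pmod (t + i + T) Q_gt0).
have p_inj : injective p.
  move=> s t /(congr1 val) /= /eqP; rewrite -!addnA eqn_modDr.
  by rewrite !modn_small // => /eqP/val_inj.
exists Q, (perm p_inj) => u e; split.
  rewrite big_split_ord /= [X in _ + X]big1 ?addr0; last first.
    by move=> t _; rewrite /trunc /= ltnNge leq_addr mul0r.
  by apply: eq_bigr => t _; rewrite /trunc /= ltn_ord.
rewrite big_split_ord /= [X in _ + X]big1 ?addr0; last first.
  by move=> t _; rewrite /trunc /= ltnNge leq_addr mul0r.
apply: eq_bigr => t _; rewrite permE /p /tshift /trunc /= ltn_ord.
congr (_ * _); case: (leqP n (t + i)) => [le_n|lt_n].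
  have -> : (t + i + T = (t + i - n) + Q)%N by rewrite /Q; lia.
  by rewrite modnDr modn_small //; move: (ltn_ord t); rewrite /Q -addnn in i_le *; lia.
by rewrite modn_small ?ltnNge ?leq_addl // /Q; lia.
Qed.

Lemma shift_correlation_le n i T u e : (i <= n.*2)%N ->
  (forall s t, 0 <= (u s - u t) * (e s - e t)) ->
  (forall t, 0 <= u t * e t) ->
  \sum_(t < T) u t * tshift n i (trunc T e) t <= \sum_(t < T) u t * e t.
Proof.
move=> /(shift_perm T)[Q [s /(_ u e)[<- <-]]] ue_mono ue_ge0.
apply: rearrangement => i1 j; rewrite /trunc; case: ifP => _; case: ifP => _ //.
all: by rewrite ?subr0 ?sub0r ?mulrNN ?mul0r.
Qed.

Lemma shift_correlation_opp n i T u e : (i <= n.*2)%N ->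
  (forall s t, 0 <= (u s - u t) * (e s - e t)) ->
  (forall s t, 0 <= (u s + u t) * (e s + e t)) ->
  (forall t, 0 <= u t * e t) ->
  - \sum_(t < T) u t * tshift n i (trunc T e) t <= \sum_(t < T) u t * e t.
Proof.
move=> /(shift_perm T)[Q [s /(_ u e)[<- <-]]] ue_mono ue_odd ue_ge0.
apply: rearrangement_opp => i1 j; rewrite /trunc; case: ifP => _; case: ifP => _ //.
all: by rewrite ?subr0 ?sub0r ?addr0 ?add0r ?mulrNN ?mul0r.
Qed.

(** The nonlinearities for which the multiplier [m] is admissible.  These classes
    grow with [K] and contain the linear gains in the sector, which is what the
    deformation of the sector relies on. *)
Definition zf_class n (K : R) (m : 'cV[R]_(n.*2.+1)) (phi : R -> R) :=
  [/\ phi 0 = 0, slope_restricted K phi &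
   (forall i : int, `|i| <= n%:Z -> i != 0 -> mcoef m i <= 0) \/ odd_fun phi].

Lemma slope_prod (K : R) phi : slope_restricted K phi ->
  forall x y, 0 <= (phi x - phi y) * ((K * x - phi x) - (K * y - phi y)).
Proof.
move=> phiK x y; have [->|xy] := eqVneq x y; first by rewrite !subrr mul0r.
have := phiK x y xy; set d := _ / _ => /andP[d0 dK].
have xy0 : x - y != 0 by rewrite subr_eq0.
have -> : phi x - phi y = d * (x - y) by rewrite /d divfK.
have -> : K * x - phi x - (K * y - phi y) = (K - d) * (x - y).
  by rewrite mulrBl /d divfK //; ring.
by rewrite mulrACA -expr2 mulr_ge0 ?sqr_ge0 // mulr_ge0 ?subr_ge0.
Qed.

(** Every shift of [e] has correlation with [u] at most [X], the unshifted one,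
    and at least [- X] when [phi] is odd.  The term of [m_0] contributes [X],
    the others at least [- |m_i| X], with total weight less than 1. *)
Lemma zames_falb n (K : R) (m : 'cV[R]_(n.*2.+1)) phi v T :
  mcoef m 0 = 1 -> \sum_(i < n.*2.+1) `|m i 0| < 2 -> zf_class K m phi ->
  0 <= shift_form m T (phi \o v) (trunc T (fun t => K * v t - phi (v t))).
Proof.
move=> m0 m_lt2 [phi0 phiK phi_class].
set u := phi \o v; set e := (fun t => _).
have ue_mono s t : 0 <= (u s - u t) * (e s - e t) by exact: slope_prod.
have ue_ge0 t : 0 <= u t * e t.
  by have := slope_prod phiK (v t) 0; rewrite phi0 mulr0 !subr0.
pose X := \sum_(t < T) u t * e t.
have X_ge0 : 0 <= X by apply: sumr_ge0.
pose i0 : 'I_(n.*2.+1) := inord n.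
have i0E : i0 = n :> nat by rewrite inordK // ltnS -addnn leq_addr.
have m_i0 : m i0 0 = 1 by rewrite -m0 /mcoef addr0.
have term (i : 'I_(n.*2.+1)) : i != i0 ->
    - `|m i 0| * X <= m i 0 * \sum_(t < T) u t * tshift n i (trunc T e) t.
  move=> ii0; have i_le : (i <= n.*2)%N by rewrite -ltnS.
  have le := shift_correlation_le T i_le ue_mono ue_ge0.
  case: phi_class => [m_le0|phi_odd].
    have mi_le0 : m i 0 <= 0.
      have := m_le0 (i%:Z - n%:Z); rewrite /mcoef (addrC n%:Z) subrK inord_val; apply.
        by have : (i <= n + n)%N; [rewrite addnn | lia].
      by rewrite subr_eq0 eqz_nat; apply: contraNneq ii0 => i_n; apply/eqP/val_inj; rewrite /= i_n i0E.
    by rewrite ler0_norm // opprK ler_wnM2l.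
  have odd_ge0 s t : 0 <= (u s + u t) * (e s + e t).
    have := slope_prod phiK (v s) (- v t); rewrite phi_odd !opprK mulrN.
    by rewrite [X in _ * X](_ : _ = e s + e t) // /e; ring.
  have := shift_correlation_opp T i_le ue_mono odd_ge0 ue_ge0.
  set Y := \sum_(t < T) _ in le *; rewrite -/X in le * => le'.
  have absY : `|Y| <= X by rewrite ler_norml lerNl le' le.
  have : `|m i 0 * Y| <= `|m i 0| * X by rewrite normrM ler_wpM2l.
  by rewrite ler_norml mulNr => /andP[].
have term0 : m i0 0 * \sum_(t < T) u t * tshift n i0 (trunc T e) t = X.
  rewrite m_i0 mul1r; apply: eq_bigr => t _.
  by rewrite /tshift i0E leq_addl addnK /trunc ltn_ord.
move: m_lt2; rewrite /shift_form (bigD1 i0) //= [X in 0 <= X](bigD1 i0) //= term0 m_i0 normr1.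
set s := \sum_(i | _) `|_|; move=> s_lt.
have : - s * X <= \sum_(i < n.*2.+1 | i != i0) m i 0 * \sum_(t < T) u t * tshift n i (trunc T e) t.
  by rewrite -sumrN mulr_suml; apply: ler_sum => i; apply: term.
by nra.
Qed.
End Correlation.

(** * Impulse responses of stable transfer functions *)

(** If [s] is the sequence for [p] and [r] a root, the sequence for
    [p * ('X - r)] is [s_(k+1) - r s_k].  Its summability passes to [s] because
    [|r| < 1], so the roots can be removed one by one. *)
Lemma annihilated_summable (F : numFieldType) (L : {poly F} -> F) (rs : seq F) :
  (forall p q, L (p - q) = L p - L q) -> (forall c p, L (c *: p) = c * L p) ->
  (forall r, r \in rs -> `|r| < 1) ->
  forall p, (forall k, L (p * \prod_(r <- rs) ('X - r%:P) * 'X^k) = 0) ->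
  exists B, forall T, \sum_(k < T) `|L (p * 'X^k)| <= B.
Proof.
move=> LB LZ; elim: rs => [_ p p0|r rs IHrs rs_lt1 p p0].
  exists 0 => T; rewrite big1 // => k _.
  by have := p0 k; rewrite big_nil mulr1 => ->; rewrite normr0.
have r_lt1 : `|r| < 1 by apply: rs_lt1; rewrite mem_head.
have [|k|B B_ge] := IHrs _ (p * ('X - r%:P)).
- by move=> s s_rs; apply: rs_lt1; rewrite inE s_rs orbT.
- by have := p0 k; rewrite big_cons !mulrA.
have B_ge0 : 0 <= B by have := B_ge 0; rewrite big_ord0.
pose s k := L (p * 'X^k).
have sS k : L (p * ('X - r%:P) * 'X^k) = s k.+1 - r * s k.
  rewrite /s -LZ -LB; congr (L _); rewrite exprS mulrBr mulrBl -mul_polyC.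
  by ring.
have r1_gt0 : 0 < 1 - `|r| by rewrite subr_gt0.
pose M := (`|s 0| + B) / (1 - `|r|).
have M_ge0 : 0 <= M by apply: divr_ge0; [apply: addr_ge0 | apply: ltW].
exists M => T.
elim: T => [|T IHT]; first by rewrite big_ord0.
rewrite big_ord_recl /=.
have le1 (k : 'I_T) : `|s (bump 0 k)| <= `|r| * `|s k| + `|L (p * ('X - r%:P) * 'X^k)|.
  rewrite /bump add1n -normrM sS.
  by have := ler_normD (r * s k) (s k.+1 - r * s k); rewrite (addrC (r * s k)) subrK.
have := ler_sum (index_enum 'I_T) (P := predT) (fun k _ => le1 k).
rewrite big_split /= -mulr_sumr => le2.
have le3 : `|s 0| + (`|r| * M + B) <= M.
  have -> : `|s 0| + (`|r| * M + B) = (`|s 0| + B) + `|r| * M by ring.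
  have -> : `|s 0| + B = M * (1 - `|r|) by rewrite /M divfK // gt_eqF.
  by rewrite mulrBr mulr1 [M * _]mulrC subrK.
apply: le_trans le3; rewrite lerD2l; apply: le_trans le2 _.
by apply: lerD; [apply: ler_wpM2l | apply: B_ge].
Qed.

(** A form of the convergence of summable sequences to 0 that asks for nothing
    but a bound on the partial sums. *)
Lemma summable_small (R : realType) (a : nat -> R) B :
  (forall k, 0 <= a k) -> (forall T, \sum_(k < T) a k <= B) ->
  forall eta L0, 0 < eta -> exists2 L, (L0 <= L)%N & a L <= eta.
Proof.
move=> a_ge0 aB eta L0 eta0; apply: contrapT => no_L.
have a_gt k : eta < a (L0 + k)%N.
  by rewrite ltNge; apply/negP => a_le; apply: no_L; exists (L0 + k)%N; rewrite ?leq_addr.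
pose M := Num.bound (B / eta).
have : B < M%:R * eta.
  rewrite -ltr_pdivrMr //; apply: archi_boundP; rewrite divr_ge0 ?(ltW eta0) //.
  by have := aB 0; rewrite big_ord0.
apply/negP; rewrite -leNgt; apply: le_trans (aB (L0 + M)%N).
rewrite big_split_ord /=; apply: le_trans (_ : \sum_(k < M) a (L0 + k)%N <= _); last first.
  by rewrite lerDr sumr_ge0.
rewrite mulr_natl -[X in _ *+ X]card_ord -sumr_const.
by apply: ler_sum => k _; apply: ltW.
Qed.

Section Impulse.
Variable R : realType.
Local Notation C := R[i].
Local Notation toC := (real_complex R).

Lemma tf_numden (G : tf R) :
  tf_den G != 0 /\ G * tf_poly (tf_den G) = tf_poly (tf_num G).
Proof.
rewrite /tf_den /tf_num; set a := (frac (repr G)).1; set b := (frac (repr G)).2.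
have b0 : b != 0 by apply: denom_ratioP.
set g := gcdp a b.
have g0 : g != 0 by rewrite gcdp_eq0 negb_and b0 orbT.
have aE : a = a %/ g * g by rewrite divpK ?dvdp_gcdl.
have bE : b = b %/ g * g by rewrite divpK ?dvdp_gcdr.
split; first by apply: contraNneq b0 => bg0; rewrite bE bg0 mul0r.
have GE : G * tf_poly b = tf_poly a.
  rewrite /tf_poly -{1}[G]reprK; unlock FracField.tofrac.
  rewrite -[LHS]FracField.pi_mul; apply/eqmodP; rewrite /= FracField.equivfE.
  rewrite /FracField.mulf !numden_Ratio ?oner_eq0 ?mulf_neq0 ?oner_eq0 // ?denom_ratioP //.
  by rewrite -/a -/b; apply/eqP; ring.
apply: (mulIf (x := tf_poly g)); first by rewrite /tf_poly tofrac_eq0.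
by rewrite -mulrA -[tf_poly _ * tf_poly g]tofracM -[RHS]tofracM -bE -aE.
Qed.

Definition poly_at (z : C) (p : {poly R}) : C := (map_poly toC p).[z].

Lemma normC_real (x : R) : `|toC x| = toC `|x|.
Proof. by rewrite normc_def /= expr0n addr0 sqrtr_sqr. Qed.

Section Stable.
Variable G : tf R.
Hypothesis G_stable : RHinf G.
Let num := tf_num G.
Let den := tf_den G.

Lemma tf_quotient_rec k : exists c : R,
  (num * 'X^(k.+1)) %/ den = 'X * ((num * 'X^k) %/ den) + c%:P.
Proof.
have [den0 _] := tf_numden G; rewrite -/den in den0.
set q := (num * 'X^k) %/ den; set r := (num * 'X^k) %% den.
have nE : num * 'X^(k.+1) = ('X * q) * den + 'X * r.
  by rewrite exprS mulrCA (divp_eq (num * 'X^k) den) -/q -/r mulrDr mulrA.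
have size_r : (size r < size den)%N by rewrite ltn_modp.
have : (size (('X * r) %/ den)%R <= 1)%N.
  rewrite size_divp // leq_subLR; apply: leq_trans (size_polyMleq _ _) _.
  by rewrite size_polyX; case: (size den) size_r => //= d; rewrite addn1 !ltnS.
move/size1_polyC; set c := _`_0 => cE; exists c; clearbody c.
by rewrite nE divp_addl_mul // -cE.
Qed.

(** The impulse response is the sequence of quotient digits in the long division
    of [num] by [den]. *)
Lemma tf_division k :
  num * 'X^k = (\sum_(j < k.+1) impulse G j *: 'X^(k - j)) * den
               + (num * 'X^k) %% den.
Proof.
rewrite {1}(divp_eq (num * 'X^k) den); congr (_ * _ + _).
elim: k => [|k IHk].
  have [den0 _] := tf_numden G; have [size_le _] := G_stable.
  rewrite big_ord1 subnn expr0 /impulse mulr1 -/num -/den alg_polyC.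
  apply: size1_polyC; rewrite size_divp // leq_subLR.
  by rewrite addn1; apply: leq_trans size_le (leqSpred _).
have [c qE] := tf_quotient_rec k.
have cE : impulse G k.+1 = c by rewrite /impulse -/num -/den qE coefD coefXM coefC /= add0r.
rewrite qE big_ord_recr /= cE subnn expr0 alg_polyC IHk; congr (_ + _).
rewrite mulr_sumr; apply: eq_bigr => j _.
by rewrite subSn -1?ltnS // -scalerAr exprS.
Qed.

Lemma den_factor : exists2 rs : seq C,
  map_poly toC den = toC (lead_coef den) *: \prod_(r <- rs) ('X - r%:P)
  & forall r, r \in rs -> `|r| < 1.
Proof.
have [den0 _] := tf_numden G; have [_ roots_lt1] := G_stable.
have [rs rsE] := closed_field_poly_normal (map_poly toC den).
have lead0 : toC (lead_coef den) != 0 by rewrite fmorph_eq0 lead_coef_eq0.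
rewrite lead_coef_map in rsE; exists rs => // r r_rs.
by apply: roots_lt1; rewrite -/den rsE rootZ // root_prod_XsubC.
Qed.

(** The real functional [L] is evaluated through its complex extension [LC]: the
    roots of the denominator, which govern the decay, are complex. *)
Lemma stable_summable (L : {poly R} -> R) (LC : {poly C} -> C) p :
  (forall p q, LC (p - q) = LC p - LC q) -> (forall c p, LC (c *: p) = c * LC p) ->
  (forall p, LC (map_poly toC p) = toC (L p)) ->
  (forall k, L (p * den * 'X^k) = 0) ->
  exists B, forall T, \sum_(k < T) `|L (p * 'X^k)| <= B.
Proof.
move=> LB LZ LE L0; have [rs rsE rs_lt1] := den_factor.
have [den0 _] := tf_numden G.
have lead0 : toC (lead_coef den) != 0 by rewrite fmorph_eq0 lead_coef_eq0.
have [|B B_ge] := annihilated_summable LB LZ rs_lt1 (p := map_poly toC p).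
  move=> k; apply: (mulfI lead0); rewrite mulr0 -LZ scalerAl scalerAr -rsE.
  by rewrite -(map_polyXn toC) -!rmorphM LE L0 rmorph0.
exists (complex.Re B) => T; have := B_ge T.
under eq_bigr => k _ do rewrite -(map_polyXn toC) -rmorphM LE normC_real.
by rewrite -rmorph_sum lecE => /andP[].
Qed.

Lemma impulse_summable : exists2 H, 0 <= H & forall T, \sum_(k < T) `|impulse G k| <= H.
Proof.
have [den0 _] := tf_numden G.
have [||||B B_ge] := @stable_summable (fun p => (p %/ den)`_0)
  (fun p => (p %/ map_poly toC den)`_0) (num * 'X).
- by move=> p q; rewrite divpD divpN coefB.
- by move=> c p; rewrite divpZl coefZ.
- by move=> p; rewrite -map_divp coef_map.
- by move=> k; rewrite mulrAC -mulrA [_ * den]mulrC mulrA mulrAC mulpK // mulrAC -mulrA -exprSr coefMXn.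
exists (`|impulse G 0| + `|B|) => [|[|T]]; first by rewrite addr_ge0.
  by rewrite big_ord0 addr_ge0.
rewrite big_ord_recl lerD2l; apply: le_trans (ler_norm B); apply: le_trans (B_ge T).
by apply: ler_sum => k _; rewrite lift0 /impulse -/num -/den exprS mulrA.
Qed.

Lemma rem_summable i : exists B, forall T, \sum_(k < T) `|((num * 'X^k) %% den)`_i| <= B.
Proof.
have [|||k|B B_ge] := @stable_summable (fun p => (p %% den)`_i)
  (fun p => (p %% map_poly toC den)`_i) num.
- by move=> p q; rewrite modpD modpN coefB.
- by move=> c p; rewrite modpZl coefZ.
- by move=> p; rewrite -map_modp coef_map.
- by rewrite mulrAC modp_mull coef0.
by exists B.
Qed.

Lemma rem_small eta L0 : 0 < eta -> exists2 L, (L0 <= L)%N &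
  \sum_(i < size den) `|((num * 'X^L) %% den)`_i| <= eta.
Proof.
have [B B_ge] : exists B, forall T,
    \sum_(k < T) \sum_(i < size den) `|((num * 'X^k) %% den)`_i| <= B.
  elim: (size den) => [|d [B B_ge]].
    by exists 0 => T; rewrite big1 // => k _; rewrite big_ord0.
  have [B' B'_ge] := rem_summable d; exists (B + B') => T.
  under eq_bigr => k _ do rewrite big_ord_recr.
  by rewrite big_split; apply: lerD; [apply: B_ge | apply: B'_ge].
by apply: (summable_small _ B_ge) => k; apply: sumr_ge0.
Qed.

(** On the circle each factor satisfies [|z - r| >= 1 - |r|]. *)
Lemma den_lower : exists2 delta : R, 0 < delta &
  forall z : C, `|z| = 1 -> toC delta <= `|poly_at z den|.
Proof.
have [den0 _] := tf_numden G; have [rs rsE rs_lt1] := den_factor.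
pose d := `|toC (lead_coef den)| * \prod_(r <- rs) (1 - `|r|).
have d_gt0 : 0 < d.
  rewrite mulr_gt0 ?normr_gt0 ?fmorph_eq0 ?lead_coef_eq0 //.
  rewrite big_seq; apply: prodr_gt0 => r /rs_lt1; by rewrite subr_gt0.
have dE : toC (complex.Re d) = d by rewrite RRe_real // gtr0_real.
exists (complex.Re d); first by rewrite -ltcR dE.
move=> z z1; rewrite dE /poly_at rsE hornerZ horner_prod normrM normr_prod.
rewrite ler_wpM2l // big_seq [leRHS]big_seq; apply: ler_prod => r r_rs.
rewrite subr_ge0 ltW ?rs_lt1 //= hornerXsubC -z1.
exact: lerB_dist.
Qed.

(** The error of the truncated series at [z] is [r_L(z) / (z^L den(z))], with
    [r_L] the remainder of the division.  Its coefficients are summable in [L]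
    and the denominator is bounded below, so the error is uniformly small for
    suitable [L]. *)
Lemma tf_series_approx eta L0 : 0 < eta -> exists2 L, (L0 <= L)%N &
  forall z : C, `|z| = 1 -> poly_at z den != 0 /\
  `|poly_at z num / poly_at z den - \sum_(k < L.+1) toC (impulse G k) * z ^- k| <= toC eta.
Proof.
move=> eta0; have [delta delta0 den_ge] := den_lower.
have [L L_ge remL] := rem_small L0 (mulr_gt0 eta0 delta0).
exists L => // z z1; have z0 : z != 0 by rewrite -normr_eq0 z1 oner_eq0.
have den_gt0 : 0 < `|poly_at z den| by apply: lt_le_trans (den_ge z z1); move: delta0; rewrite -ltcR.
have denz0 : poly_at z den != 0 by rewrite -normr_gt0.
split=> //.
have evE : poly_at z num * z ^+ L =
    (\sum_(k < L.+1) toC (impulse G k) * z ^+ (L - k)) * poly_at z den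
     + poly_at z ((num * 'X^L) %% den).
  have := congr1 (poly_at z) (tf_division L).
  rewrite /poly_at rmorphM /= map_polyXn hornerM hornerXn => ->.
  rewrite rmorphD rmorphM /= hornerD hornerM rmorph_sum /= horner_sum; congr (_ * _ + _).
  by apply: eq_bigr => k _; rewrite map_polyZ map_polyXn hornerZ hornerXn.
have -> : poly_at z num / poly_at z den - \sum_(k < L.+1) toC (impulse G k) * z ^- k =
    poly_at z ((num * 'X^L) %% den) / (poly_at z den * z ^+ L).
  have zL0 : z ^+ L != 0 by rewrite expf_neq0.
  have -> : \sum_(k < L.+1) toC (impulse G k) * z ^- k =
      (\sum_(k < L.+1) toC (impulse G k) * z ^+ (L - k)) / z ^+ L.
    rewrite mulr_suml; apply: eq_bigr => k _; rewrite -mulrA; congr (_ * _).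
    have kL : (k <= L)%N by rewrite -ltnS.
    apply: (mulIf zL0); rewrite divfK //.
    have -> : z ^+ L = z ^+ (L - k) * z ^+ k by rewrite -exprD subnK.
    by rewrite mulrCA mulVf ?mulr1 ?expf_neq0.
  rewrite -[poly_at z ((num * 'X^L) %% den)](addKr ((\sum_(k < L.+1) toC (impulse G k) * z ^+ (L - k)) * poly_at z den)).
  rewrite -evE; field; by rewrite zL0 denz0.
rewrite normrM normfV normrM normrX z1 expr1n mulr1 ler_pdivrMr //.
apply: le_trans (_ : toC (eta * delta) <= _); last first.
  by rewrite rmorphM /=; apply: ler_wpM2l; [rewrite ler0c ltW | apply: den_ge].
apply: le_trans (_ : toC (\sum_(i < size den) `|((num * 'X^L) %% den)`_i|) <= _); last first.
  by rewrite lecR.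
rewrite /poly_at (@horner_coef_wide _ (size den)); last first.
  by apply: leq_trans (size_poly _ _) _; rewrite ltnW // ltn_modp; have [] := tf_numden G.
rewrite rmorph_sum /=; apply: le_trans (ler_norm_sum _ _ _) _.
by apply: ler_sum => i _; rewrite coef_map normrM normrX z1 expr1n mulr1 normC_real.
Qed.

End Stable.
End Impulse.

(** * Quadratic forms of the matrix inequality *)

Section LMI.
Variable R : realType.

Definition quad_form k (P : 'M[R]_k) (x : 'cV[R]_k) : R := (x^T *m P *m x) 0 0.

(** With [S] the positive definite form opposite to [P] and [c] the vector that
    represents the last coordinate for [S], the Cauchy-Schwarz inequality for [S]
    bounds [w^2] by [S(c, c)] times the form.  This replaces a compactness
    argument on the sphere. *)
Lemma neg_def_margin N (P : 'M[R]_(N + 1)) : neg_def P ->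
  exists2 eps, 0 < eps & forall x (w : R),
    quad_form P (col_mx x w%:M) <= - (eps * w ^+ 2).
Proof.
move=> P_neg; pose S := - (P + P^T).
have S_sym : S^T = S by rewrite /S linearN linearD /= trmxK addrC.
have mx11tr (M : 'M[R]_1) : M^T 0 0 = M 0 0 by rewrite mxE.
have quadS x : quad_form S x = - (quad_form P x *+ 2).
  rewrite /quad_form /S mulmxN mulNmx mulmxDr mulmxDl [LHS]mxE [X in - X]mxE mulr2n.
  congr (- (_ + _)); rewrite -[LHS]mx11tr !trmx_mul !trmxK.
  by rewrite mulmxA.
have S_pos x : x != 0 -> 0 < quad_form S x.
  by move=> x0; rewrite quadS oppr_gt0 pmulrn_llt0 //; apply: P_neg.
have S_ge0 x : 0 <= quad_form S x.
  have [->|/S_pos/ltW//] := eqVneq x 0.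
  by rewrite /quad_form mulmx0 mxE.
have S_unit : S \in unitmx.
  rewrite unitmxE unitfE; apply/det0P => -[v v0 vS].
  have := S_pos v^T; rewrite /quad_form trmxK vS mul0mx mxE ltxx => h.
  by move: v0; rewrite -trmx_eq0 => /h.
pose e : 'cV[R]_(N + 1) := col_mx 0 1%:M.
pose c := invmx S *m e.
have Sc : S *m c = e by rewrite /c mulKVmx.
clearbody c.
have c0 : c != 0.
  apply/eqP => c0; have /matrixP/(_ (rshift N 0) 0) := Sc.
  by rewrite c0 mulmx0 /e col_mxEd !mxE eqxx => /eqP; rewrite eq_sym oner_eq0.
pose gamma := quad_form S c; have gamma_gt0 : 0 < gamma by apply: S_pos.
exists (2 * gamma)^-1; first by rewrite invr_gt0 mulr_gt0.
move=> x w; set p := col_mx x w%:M.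
have cSp : (c^T *m S *m p) 0 0 = w.
  by rewrite -[S]S_sym -trmx_mul Sc /e tr_col_mx mul_row_col trmx0 mul0mx add0r trmx1 mul1mx mxE eqxx.
have pSc : (p^T *m S *m c) 0 0 = w.
  by rewrite -[LHS]mx11tr !trmx_mul trmxK S_sym mulmxA cSp.
pose t := w / gamma.
have := S_ge0 (p - t *: c).
have -> : quad_form S (p - t *: c) = quad_form S p - 2 * t * w + t ^+ 2 * gamma.
  have -> : quad_form S (p - t *: c) = ((p^T - t *: c^T) *m S *m (p - t *: c)) 0 0.
    by rewrite /quad_form [(p - _)^T]linearB /= [(t *: c)^T]linearZ.
  rewrite !(mulmxBl, mulmxBr) -!(scalemxAl, scalemxAr).
  have subE (M M' : 'M[R]_1) : (M - M') 0 0 = M 0 0 - M' 0 0 by rewrite !mxE.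
  have scE (k : R) (M : 'M[R]_1) : (k *: M) 0 0 = k * M 0 0 by rewrite !mxE.
  rewrite !(subE, scE) cSp pSc -/(quad_form S c) -/gamma -/(quad_form S p); ring.
rewrite quadS /t => h.
have : - (quad_form P p *+ 2) - 2 * (w / gamma) * w + (w / gamma) ^+ 2 * gamma
    = - (quad_form P p *+ 2) - w ^+ 2 / gamma by field; rewrite gt_eqF.
move: h => /[swap] -> h.
have -> : (2 * gamma)^-1 * w ^+ 2 = (w ^+ 2 / gamma) / 2 by field; rewrite gt_eqF.
lra.
Qed.

Lemma lmi_quad p N (A X : 'M[R]_N) (B : 'M[R]_(N, 1)) (C : 'M[R]_(p, N))
    (D : 'M[R]_(p, 1)) (Ka : 'M[R]_p) x u :
  quad_form (block_mx (A^T *m X *m A - X) (A^T *m X *m B)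
              (B^T *m X *m A) (B^T *m X *m B)
     + (row_mx C D)^T *m Ka *m row_mx C D) (col_mx x u) =
  quad_form X (A *m x + B *m u) - quad_form X x + quad_form Ka (C *m x + D *m u).
Proof.
have quadM k l (M : 'M[R]_(k, l)) (Q : 'M[R]_k) y : quad_form (M^T *m Q *m M) y = quad_form Q (M *m y).
  by rewrite /quad_form trmx_mul !mulmxA.
have quadD k (Q Q' : 'M[R]_k) y : quad_form (Q + Q') y = quad_form Q y + quad_form Q' y.
  by rewrite /quad_form mulmxDr mulmxDl mxE.
have quadN k (Q : 'M[R]_k) y : quad_form (- Q) y = - quad_form Q y.
  by rewrite /quad_form mulmxN mulNmx mxE.
rewrite quadD quadM mul_row_col.
have -> : block_mx (A^T *m X *m A - X) (A^T *m X *m B) (B^T *m X *m A) (B^T *m X *m B)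
  = (row_mx A B)^T *m X *m row_mx A B - (row_mx 1%:M 0)^T *m X *m row_mx 1%:M 0.
  rewrite !tr_row_mx ![col_mx _ _ *m X]mul_col_mx !mul_col_row opp_block_mx add_block_mx.
  by rewrite trmx1 mul1mx mulmx1 !mulmx0 trmx0 !mul0mx !subr0.
by rewrite quadD quadN !quadM !mul_row_col mul1mx mul0mx addr0.
Qed.

Lemma big_two_sided (F : nat -> R) n :
  \sum_(i < n.*2.+1) F i = \sum_(k < n) F (n - k.+1)%N + \sum_(j < n.+1) F (n + j)%N.
Proof.
have -> : n.*2.+1 = (n + n.+1)%N by rewrite addnS addnn.
by rewrite big_split_ord (reindex_inj rev_ord_inj).
Qed.

(** The summands are arranged by the position of [m_i]: nonnegative [i] shift the
    second block against the first entry of the first, negative [i] the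
    converse. *)
Lemma kappa_quad n K (m : 'cV[R]_(n.*2.+1)) (a b : 'cV[R]_n.+1) :
  quad_form (kappa K m) (col_mx a b) =
  2 * \sum_(i < n.*2.+1) m i 0 *
    (if (n <= i)%N then (K * a 0 0 - b 0 0) * b (inord (i - n)) 0
     else (K * a (inord (n - i)) 0 - b (inord (n - i)) 0) * b 0 0).
Proof.
pose F i := m (inord i) 0 *
    (if (n <= i)%N then (K * a 0 0 - b 0 0) * b (inord (i - n)) 0
     else (K * a (inord (n - i)) 0 - b (inord (n - i)) 0) * b 0 0).
rewrite (eq_bigr (fun i : 'I_(n.*2.+1) => F i)); last first.
  by move=> i _; rewrite /F inord_val.
pose mp j := mcoef m j%:Z; pose mn j := mcoef m (- j%:Z).
have Fp j : (j < n.+1)%N -> F (n + j)%N = mp j * ((K * a 0 0 - b 0 0) * b (inord j) 0).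
  by move=> _; rewrite /F leq_addr addKn /mp /mcoef -PoszD absz_nat.
have Fn k : (k < n)%N -> F (n - k.+1)%N =
    mn k.+1 * ((K * a (inord k.+1) 0 - b (inord k.+1) 0) * b 0 0).
  move=> kn; rewrite /F leqNgt ltn_subrL (leq_ltn_trans _ kn) //= subKn //.
  by rewrite /mn /mcoef subzn // absz_nat.
rewrite big_two_sided (eq_bigr _ (fun k _ => Fn _ (ltn_ord k))).
rewrite [X in _ + X](eq_bigr _ (fun j _ => Fp _ (ltn_ord j))).
rewrite [X in _ + X]big_ord_recl.
pose sP := \sum_(k < n) mp k.+1 * b (inord k.+1) 0.
pose sQ := \sum_(k < n) mn k.+1 * b (inord k.+1) 0.
pose sR := \sum_(k < n) mn k.+1 * a (inord k.+1) 0.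
have mp0 : mn 0 = mp 0 by rewrite /mn /mp oppr0.
have inordS (i : 'I_n) : inord i.+1 = lift ord0 i :> 'I_n.+1.
  by apply: val_inj; rewrite /= inordK // ltnS.
have inord00 : inord 0 = 0 :> 'I_n.+1 by apply: val_inj; rewrite /= inordK.
have -> : \sum_(i < n) mn i.+1 * ((K * a (inord i.+1) 0 - b (inord i.+1) 0) * b 0 0)
   = (K * sR - sQ) * b 0 0.
  rewrite /sR /sQ mulr_sumr -sumrB mulr_suml; apply: eq_bigr => k _; ring.
have -> : \sum_(i < n) mp (lift ord0 i) * ((K * a 0 0 - b 0 0) * b (inord (lift ord0 i)) 0)
   = (K * a 0 0 - b 0 0) * sP.
  by rewrite /sP mulr_sumr; apply: eq_bigr => k _; rewrite lift0; ring.
have RE : (a^T *m (kappaR K m *m b)) 0 0 =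
    a 0 0 * (K * (mp 0 * b 0 0 + sP)) + K * sR * b 0 0.
  rewrite mxE big_ord_recl; congr (_ + _).
    rewrite !mxE; congr (_ * _); rewrite big_ord_recl /sP mulrDr mulr_sumr mulrA; congr (_ + _).
      by rewrite !mxE.
    by apply: eq_bigr => k _; rewrite !mxE /= inordS mulrA.
  rewrite /sR mulr_sumr mulr_suml; apply: eq_bigr => k _.
  rewrite !mxE big_ord_recl [X in _ + X]big1 ?addr0; last by move=> j _; rewrite !mxE /= mul0r.
  by rewrite !mxE /= inordS /mn; ring.
have S0 : (kappaS m *m b) 0 0 = - (2 * mp 0 * b 0 0) - sP - sQ.
  rewrite mxE big_ord_recl -addrA; congr (_ + _).
    by rewrite !mxE /= -/(mn 0) mp0 /mp; ring.
  rewrite -opprD /sP /sQ -big_split -sumrN; apply: eq_bigr => k _.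
  by rewrite !mxE /= inordS /mp /mn; ring.
have Sk k : (kappaS m *m b) (lift ord0 k) 0 = (- mp k.+1 - mn k.+1) * b 0 0.
  rewrite mxE big_ord_recl [X in _ + X]big1 ?addr0; last by move=> j _; rewrite !mxE /= mul0r.
  by rewrite !mxE.
have SE : (b^T *m (kappaS m *m b)) 0 0 =
    - (2 * mp 0 * b 0 0 ^+ 2) - 2 * b 0 0 * (sP + sQ).
  rewrite mxE big_ord_recl S0 [in LHS]mxE.
  have -> : \sum_(i < n) b^T 0 (lift ord0 i) * (kappaS m *m b) (lift ord0 i) 0 = - (sP + sQ) * b 0 0.
    rewrite /sP /sQ -big_split -sumrN mulr_suml; apply: eq_bigr => k _.
    by rewrite Sk mxE /= inordS; ring.
  ring.
rewrite /quad_form /kappa tr_col_mx mul_row_block mulmx0 add0r mul_row_col.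
have mx11D (M M' : 'M[R]_1) : (M + M') 0 0 = M 0 0 + M' 0 0 by rewrite mxE.
rewrite mulmxDl !mx11D -!mulmxA RE SE.
have -> : (b^T *m ((kappaR K m)^T *m a)) 0 0 = (a^T *m (kappaR K m *m b)) 0 0.
  have <- : (a^T *m (kappaR K m *m b))^T 0 0 = (a^T *m (kappaR K m *m b)) 0 0 by rewrite mxE.
  by rewrite !trmx_mul trmxK mulmxA.
rewrite RE inord00 [nat_of_ord _]/=; ring.
Qed.

End LMI.


(** * Polynomial form of the state-space description *)

Section StateSpace.
Variable R : realType.
Local Notation tofrac := (@FracField.tofrac {poly R}).
Local Notation polyM := (map_mx (@polyC R)).

(** Multiplying by the characteristic polynomial and using the adjugate turns the
    equations of the resolvent into polynomial identities, which can be evaluated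
    at complex points. *)
Lemma state_space_poly p q N (H : 'M[tf R]_(p, q)) (A : 'M[R]_N) (B : 'M[R]_(N, q))
    (C : 'M[R]_(p, N)) (D : 'M[R]_(p, q)) : state_space H A B C D ->
  let V := \adj (char_poly_mx A) *m polyM B in
  'X *: V - polyM A *m V = char_poly A *: polyM B /\
  tofrac (char_poly A) *: H =
    map_mx tofrac (polyM C *m V + char_poly A *: polyM D).
Proof.
move=> -> V; split.
  rewrite /V -mul_scalar_mx -(mulmxBl 'X%:M) mulmxA mul_mx_adj.
  by rewrite mul_scalar_mx.
rewrite /ss_tf.
have constE k l (M : 'M[R]_(k, l)) : map_mx (@tf_const R) M = map_mx tofrac (polyM M).
  by rewrite -map_mx_comp.
have -> : (tf_z R)%:M - map_mx (@tf_const R) A = map_mx tofrac (char_poly_mx A).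
  by rewrite /char_poly_mx map_mxB map_scalar_mx constE.
have chi0 : char_poly A != 0 by rewrite monic_neq0 ?char_poly_monic.
have unitA : map_mx tofrac (char_poly_mx A) \in unitmx.
  by rewrite unitmxE det_map_mx unitfE tofrac_eq0.
rewrite /invmx unitA det_map_mx -/(char_poly A) -map_mx_adj.
rewrite !constE -scalemxAr -scalemxAl scalerDr scalerA divff ?tofrac_eq0 // scale1r.
by rewrite -!map_mxM -map_mxZ -map_mxD mulmxA.
Qed.

Lemma PsiG_entry n (G : tf R) (i : 'I_n.+1) :
  (Psi R n *m col_mx (- G)%:M 1%:M) (lshift n.+1 i) 0 = - (G * tf_z R ^- i) /\
  (Psi R n *m col_mx (- G)%:M 1%:M) (rshift n.+1 i) 0 = tf_z R ^- i.
Proof.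
rewrite /Psi mul_block_col !mul0mx addr0 add0r mulmx1 mul_mx_scalar.
by rewrite col_mxEu col_mxEd !mxE mulNr.
Qed.

(** Stated over an abstract field, where [field] need not compute with
    fractions. *)
Lemma cancel_delay (F : fieldType) (c g z d : F) :
  z != 0 -> c * - (g / z) * z * d = - (g * d * c).
Proof. by move=> z0; field. Qed.

Lemma PsiG_poly n (G : tf R) N (A : 'M[R]_N) (B : 'M[R]_(N, 1))
    (C : 'M[R]_(n.+1 + n.+1, N)) (D : 'M[R]_(n.+1 + n.+1, 1)) :
  state_space (Psi R n *m col_mx (- G)%:M 1%:M) A B C D ->
  let U := polyM C *m (\adj (char_poly_mx A) *m polyM B) + char_poly A *: polyM D in
  forall i : 'I_n.+1,
    U (lshift n.+1 i) 0 * 'X^i * tf_den G = - (tf_num G * char_poly A) /\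
    U (rshift n.+1 i) 0 * 'X^i = char_poly A.
Proof.
move=> /state_space_poly[_ HU] U i; rewrite -/U in HU.
have entry j : tofrac (U j 0) = tofrac (char_poly A) * (Psi R n *m col_mx (- G)%:M 1%:M) j 0.
  by have /matrixP/(_ j 0) := HU; rewrite !mxE.
have z0 : tf_z R ^+ i != 0 by rewrite expf_neq0 // tofrac_eq0 polyX_eq0.
have [GE1 GE2] := PsiG_entry G i; have [_ GE] := tf_numden G.
split; apply/eqP; rewrite -tofrac_eq; apply/eqP; rewrite ?(tofracN, tofracM, tofracXn) entry.
  rewrite GE1 -[tofrac (tf_num G)]GE /tf_poly -/(tf_z R).
  exact: cancel_delay.
by rewrite GE2 mulfVK.
Qed.

End StateSpace.

(** * The frequency-domain inequality *)

Section Frequency.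
Variable R : realType.
Local Notation C := R[i].
Local Notation toC := (real_complex R).
Local Notation Re := (@complex.Re R).
Local Notation Im := (@complex.Im R).

Section PolyAt.
Variable z : C.
Lemma poly_atD p q : poly_at z (p + q) = poly_at z p + poly_at z q.
Proof. by rewrite /poly_at rmorphD hornerD. Qed.
Lemma poly_atN p : poly_at z (- p) = - poly_at z p.
Proof. by rewrite /poly_at rmorphN hornerN. Qed.
Lemma poly_atM p q : poly_at z (p * q) = poly_at z p * poly_at z q.
Proof. by rewrite /poly_at rmorphM hornerM. Qed.
Lemma poly_atC c : poly_at z c%:P = toC c.
Proof. by rewrite /poly_at map_polyC hornerC. Qed.
Lemma poly_atXn k : poly_at z 'X^k = z ^+ k.
Proof. by rewrite /poly_at map_polyXn hornerXn. Qed.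
Lemma poly_at_sum k (F : 'I_k -> {poly R}) : poly_at z (\sum_i F i) = \sum_i poly_at z (F i).
Proof. by rewrite /poly_at rmorph_sum horner_sum. Qed.
End PolyAt.

Lemma ReD (x y : C) : Re (x + y) = Re x + Re y. Proof. by case: x y => ? ? []. Qed.
Lemma ImD (x y : C) : Im (x + y) = Im x + Im y. Proof. by case: x y => ? ? []. Qed.
Lemma ReZ a (x : C) : Re (toC a * x) = a * Re x.
Proof. by case: x => x y /=; ring. Qed.
Lemma ImZ a (x : C) : Im (toC a * x) = a * Im x.
Proof. by case: x => x y /=; ring. Qed.
Lemma Re_sum k (F : 'I_k -> C) : Re (\sum_i F i) = \sum_i Re (F i).
Proof. by apply: (big_morph Re ReD). Qed.
Lemma Im_sum k (F : 'I_k -> C) : Im (\sum_i F i) = \sum_i Im (F i).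
Proof. by apply: (big_morph Im ImD). Qed.

Lemma unit_conj (z : C) : `|z| = 1 -> conjc z = z^-1.
Proof.
move=> z1; have z0 : z != 0 by rewrite -normr_eq0 z1 oner_eq0.
by apply: (mulfI z0); rewrite -sqr_normc z1 expr1n divff.
Qed.

Lemma dot_Re (x y : C) : Re x * Re y + Im x * Im y = Re (x * conjc y).
Proof. by case: x y => ? ? [? ?] /=; ring. Qed.

Definition tf_at (G : tf R) (z : C) : C := poly_at z (tf_num G) / poly_at z (tf_den G).

Definition multiplier n (m : 'cV[R]_(n.*2.+1)) (z : C) : C :=
  \sum_i toC (m i 0) * (z ^+ i / z ^+ n).

Variables (K : R) (G : tf R) (n N : nat).
Variables (A : 'M[R]_N) (B : 'M[R]_(N, 1)) (Cm : 'M[R]_(n.+1 + n.+1, N)).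
Variables (D : 'M[R]_(n.+1 + n.+1, 1)) (X : 'M[R]_N) (m : 'cV[R]_(n.*2.+1)).
Hypothesis ssG : state_space (Psi R n *m col_mx (- G)%:M 1%:M) A B Cm D.
Hypothesis lmi : neg_def
    (block_mx (A^T *m X *m A - X) (A^T *m X *m B)
              (B^T *m X *m A) (B^T *m X *m B)
     + (row_mx Cm D)^T *m kappa K m *m row_mx Cm D).

(** The state [x = (z - A)^-1 B], split into real and imaginary parts, is inserted
    in the matrix inequality.  The next state is [z x], and a rotation by [z]
    preserves the sum of the two values of the form [X], so that only the term
    with [kappa] survives; the output is [(- G(z) / z^i, 1 / z^i)]. *)
Lemma frequency_inequality : exists2 eps : R, 0 < eps &
  forall z : C, `|z| = 1 -> poly_at z (char_poly A) != 0 -> poly_at z (tf_den G) != 0 ->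
    eps <= Re (multiplier m z * (1 + toC K * tf_at G z)).
Proof.
have [eps eps0 marg] := neg_def_margin lmi.
exists (eps / 2); first by rewrite divr_gt0.
move=> z z1 chi0 den0.
have z0 : z != 0 by rewrite -normr_eq0 z1 oner_eq0.
have zX0 k : z ^+ k != 0 by rewrite expf_neq0.
pose chi := poly_at z (char_poly A); rewrite -/chi in chi0.
have [VE _] := state_space_poly ssG; have UE := PsiG_poly ssG.
move: (\adj _ *m _) VE UE => V VE; set U := _ + _ => UE.
pose x k : C := poly_at z (V k 0) / chi.
have xE k : z * x k = \sum_j toC (A k j) * x j + toC (B k 0).
  have /(congr1 (poly_at z)) : ('X *: V - map_mx polyC A *m V) k 0 = (char_poly A *: map_mx polyC B) k 0.
    by rewrite VE.
  rewrite !mxE poly_atD poly_atN !poly_atM -['X]expr1 poly_atXn poly_at_sum poly_atC -/chi => h.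
  have -> : \sum_j toC (A k j) * x j = (\sum_j poly_at z ((map_mx polyC A) k j * V j 0)) / chi.
    by rewrite mulr_suml; apply: eq_bigr => j _; rewrite poly_atM mxE poly_atC mulrA.
  have -> : toC (B k 0) = chi * toC (B k 0) / chi by rewrite mulrAC divff // mul1r.
  by rewrite -h /x expr1; ring.
have yE i : \sum_j toC (Cm i j) * x j + toC (D i 0) = poly_at z (U i 0) / chi.
  rewrite !mxE poly_atD poly_atM poly_atC poly_at_sum mulrDl -/chi mulrAC divff // mul1r; congr (_ + _).
  by rewrite mulr_suml; apply: eq_bigr => j _; rewrite poly_atM mxE poly_atC mulrA.
have yt i : poly_at z (U (lshift n.+1 i) 0) / chi = - tf_at G z / z ^+ i.
  have [/(congr1 (poly_at z)) + _] := UE i.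
  rewrite poly_atN !poly_atM poly_atXn -/chi /tf_at => h.
  apply: (mulIf chi0); rewrite divfK //; apply: (mulIf (zX0 i)); apply: (mulIf den0).
  by rewrite h; field; rewrite den0 zX0.
have yb i : poly_at z (U (rshift n.+1 i) 0) / chi = (z ^+ i)^-1.
  have [_ /(congr1 (poly_at z))] := UE i.
  rewrite poly_atM poly_atXn -/chi => h.
  by apply: (mulIf chi0); rewrite divfK //; apply: (mulIf (zX0 i)); rewrite h mulrAC mulVf ?mul1r.
pose x1 : 'cV[R]_N := \col_k Re (x k); pose x2 : 'cV[R]_N := \col_k Im (x k).
pose a1 : 'cV[R]_n.+1 := \col_i Re (- tf_at G z / z ^+ i).
pose a2 : 'cV[R]_n.+1 := \col_i Im (- tf_at G z / z ^+ i).
pose b1 : 'cV[R]_n.+1 := \col_i Re ((z ^+ i)^-1).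
pose b2 : 'cV[R]_n.+1 := \col_i Im ((z ^+ i)^-1).
have ReAx k l (M : 'M[R]_(k, l)) (v : 'I_l -> C) i :
    (M *m \col_j Re (v j)) i 0 = Re (\sum_j toC (M i j) * v j).
  by rewrite mxE Re_sum; apply: eq_bigr => j _; rewrite mxE ReZ.
have ImAx k l (M : 'M[R]_(k, l)) (v : 'I_l -> C) i :
    (M *m \col_j Im (v j)) i 0 = Im (\sum_j toC (M i j) * v j).
  by rewrite mxE Im_sum; apply: eq_bigr => j _; rewrite mxE ImZ.
have ImC r : Im (toC r) = 0 by [].
have Ax1 : A *m x1 + B *m 1%:M = Re z *: x1 - Im z *: x2.
  apply/matrixP => k j; rewrite (ord1 j) mulmx1 mxE ReAx -[B k 0]/(Re (toC (B k 0))) -ReD -xE !mxE.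
  by case: (z) (x k) => ? ? [].
have Ax2 : A *m x2 + B *m 0%:M = Re z *: x2 + Im z *: x1.
  apply/matrixP => k j; rewrite (ord1 j) raddf0 mulmx0 addr0 ImAx.
  rewrite -[LHS]addr0 -[X in _ + X = _](ImC (B k 0)) -ImD -xE !mxE.
  by case: (z) (x k) => ? ? [].
have Cx1 : Cm *m x1 + D *m 1%:M = col_mx a1 b1.
  apply/matrixP => k j; rewrite (ord1 j) mulmx1 mxE ReAx -[D k 0]/(Re (toC (D k 0))) -ReD yE.
  by case: (split_ordP k) => i ->; rewrite ?(col_mxEu, col_mxEd) [RHS]mxE ?(yt, yb).
have Cx2 : Cm *m x2 + D *m 0%:M = col_mx a2 b2.
  apply/matrixP => k j; rewrite (ord1 j) raddf0 mulmx0 addr0 ImAx.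
  rewrite -[LHS]addr0 -[X in _ + X = _](ImC (D k 0)) -ImD yE.
  by case: (split_ordP k) => i ->; rewrite ?(col_mxEu, col_mxEd) [RHS]mxE ?(yt, yb).
have := lerD (marg x1 1) (marg x2 0).
rewrite !lmi_quad Ax1 Ax2 Cx1 Cx2.
have quadX : quad_form X (Re z *: x1 - Im z *: x2) + quad_form X (Re z *: x2 + Im z *: x1) =
    quad_form X x1 + quad_form X x2.
  have z2 : Re z ^+ 2 + Im z ^+ 2 = 1.
    by apply: (@complexI R); rewrite add_Re2_Im2 z1 expr1n.
  rewrite -[RHS]mul1r -z2.
  have quadDs s t (u v : 'cV[R]_N) : quad_form X (s *: u + t *: v) =
    s ^+ 2 * quad_form X u + s * t * ((u^T *m X *m v) 0 0 + (v^T *m X *m u) 0 0) + t ^+ 2 * quad_form X v.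
    rewrite /quad_form.
    have -> : (s *: u + t *: v)^T = s *: u^T + t *: v^T.
      by rewrite [LHS]linearD /= [(s *: u)^T]linearZ [(t *: v)^T]linearZ.
    rewrite !(mulmxDl, mulmxDr) -!(scalemxAl, scalemxAr).
    have adE (M M' : 'M[R]_1) : (M + M') 0 0 = M 0 0 + M' 0 0 by rewrite !mxE.
    have scE (k : R) (M : 'M[R]_1) : (k *: M) 0 0 = k * M 0 0 by rewrite !mxE.
    by rewrite !(adE, scE); ring.
  by rewrite -scaleNr !quadDs; ring.
have ReN (u : C) : Re (- u) = - Re u by case: u.
have KRe (u v : C) : K * Re u - Re v = Re (toC K * u - v) by rewrite ReD ReN ReZ.
have KIm (u v : C) : K * Im u - Im v = Im (toC K * u - v).
  by rewrite ImD ImZ; case: v.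
have quadK : quad_form (kappa K m) (col_mx a1 b1) + quad_form (kappa K m) (col_mx a2 b2) =
    - (2 * Re (multiplier m z * (1 + toC K * tf_at G z))).
  rewrite !kappa_quad -mulrDr -big_split /= -mulrN; congr (_ * _).
  rewrite /multiplier mulr_suml Re_sum -sumrN; apply: eq_bigr => i _.
  rewrite -mulrDr -[toC _ * _ * _]mulrA ReZ -mulrN; congr (_ * _).
  have i_le : (i <= n.*2)%N by rewrite -ltnS.
  case: leqP => [n_le|lt_n].
    have jn : (i - n < n.+1)%N by rewrite ltnS leq_subLR addnn.
    rewrite !mxE inordK // KRe KIm dot_Re -ReN; congr Re.
    rewrite conjc_inv rmorphXn /= unit_conj // exprVn invrK expr0 !divr1.
    have -> : z ^+ i / z ^+ n = z ^+ (i - n).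
      by apply: (mulIf (zX0 n)); rewrite divfK // -exprD subnK.
    by rewrite invr1; ring.
  have jn : (n - i < n.+1)%N by rewrite ltnS leq_subr.
  rewrite !mxE inordK // KRe KIm dot_Re -ReN; congr Re.
  rewrite conjc_inv rmorphXn /= expr0 invr1 mulr1.
  have -> : z ^+ i / z ^+ n = (z ^+ (n - i))^-1.
    by apply: (mulIf (zX0 n)); rewrite divfK // -[in z ^+ n](subnK (ltnW lt_n)) exprD mulKf.
  by ring.
rewrite expr1n expr0n mulr0 mulr1 oppr0 addr0.
by move: quadX quadK; lra.
Qed.

End Frequency.

(** * Sums over roots of unity *)

Section RootsOfUnity.
Variable C : numClosedFieldType.

Lemma primitive_root_exists P : (0 < P)%N -> exists z : C, P.-primitive_root z.
Proof.
move=> P0; pose p : {poly C} := 'X^P - 1; have [r pE] := closed_field_poly_normal p.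
rewrite (monicP _) ?monicXnsubC // scale1r in pE.
have r1 : all P.-unity_root r by apply/allP=> z; rewrite -root_prod_XsubC -pE.
have sz_r : (P < (size r).+1)%N by rewrite -(size_prod_XsubC r id) -pE size_XnsubC.
have [|z] := hasP (has_prim_root P0 r1 _ sz_r); last by exists z.
by rewrite -separable_prod_XsubC -pE separable_Xn_sub_1 // pnatr_eq0 -lt0n.
Qed.

Lemma prim_root_norm P (z : C) : P.-primitive_root z -> `|z| = 1.
Proof.
move=> zP; have P0 := prim_order_gt0 zP.
by apply/eqP; rewrite -(pexpr_eq1 P0) // -normrX (prim_expr_order zP) normr1.
Qed.

(** A primitive root of unity of large order has more powers than the polynomial
    has roots. *)
Lemma unit_circle_nonroot (q : {poly C}) : q != 0 -> exists2 z : C, `|z| = 1 & q.[z] != 0.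
Proof.
move=> q0; have [w wP] := primitive_root_exists (ltn0Sn (size q)).
apply: contrapT => no_z.
have q_root (k : nat) : root q (w ^+ k).
  apply/negP => q_k; apply: no_z; exists (w ^+ k).
    by rewrite normrX (prim_root_norm wP) expr1n.
  by apply/negP.
pose rs := [seq w ^+ k | k <- iota 0 (size q).+1].
(* if no power of w avoided the roots, q would have more roots than its size *)
have rs_root : all (root q) rs by apply/allP => _ /mapP[k _ ->].
have rs_uniq : uniq rs.
  rewrite map_inj_in_uniq ?iota_uniq // => i j; rewrite !mem_iota !add0n => iP jP /eqP.
  by rewrite (eq_prim_root_expr wP) !modn_small // => /eqP.
by have := max_poly_roots q0 rs_root rs_uniq; rewrite size_map size_iota ltnNge leqnSn.
Qed.

(** The usual orthogonality, at roots of unity rotated by [t]; the rotation allows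
    the sample points to avoid a finite set. *)
Lemma twisted_dft P (w t : C) a b : P.-primitive_root w -> t != 0 ->
  (a < P)%N -> (b < P)%N ->
  \sum_(s < P) (t * w ^+ s) ^+ a / (t * w ^+ s) ^+ b = P%:R * (a == b)%:R.
Proof.
move=> wP t0 aP bP.
have w0 : w != 0 by rewrite -normr_eq0 (prim_root_norm wP) oner_eq0.
have tw0 s : t * w ^+ s != 0 by rewrite mulf_neq0 ?expf_neq0.
have [->|ab] := eqVneq a b.
  rewrite (eq_bigr (fun=> 1)) ?sumr_const ?card_ord ?mulr1 // => s _.
  by rewrite divff // expf_neq0.
rewrite mulr0; pose q := w ^+ a / w ^+ b.
rewrite (eq_bigr (fun s : 'I_P => t ^+ a / t ^+ b * q ^+ s)); last first.
  move=> s _; rewrite /q !exprMn exprVn -!exprM ![(s * _)%N]mulnC.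
  by rewrite invfM mulrACA.
rewrite -mulr_sumr; suff -> : \sum_(s < P) q ^+ s = 0 by rewrite mulr0.
have q1 : q != 1.
  apply: contraNneq ab => q1; rewrite -[a](modn_small aP) -[b](modn_small bP).
  rewrite -(eq_prim_root_expr wP); apply/eqP/(mulIf (x := (w ^+ b)^-1)).
    by rewrite invr_eq0 expf_neq0.
  by rewrite -/q q1 divff // expf_neq0.
have := subrX1 q P.
have -> : q ^+ P = 1 by rewrite /q exprMn exprVn -!exprM ![(_ * P)%N]mulnC !exprM (prim_expr_order wP) !expr1n invr1 mulr1.
rewrite subrr => /esym/eqP; rewrite mulf_eq0 subr_eq0 (negbTE q1) /=.
by move/eqP.
Qed.

Lemma avoiding_twist P (w : C) (chi : {poly C}) : w != 0 -> chi != 0 ->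
  exists2 t, `|t| = 1 & forall s, (s < P)%N -> chi.[t * w ^+ s] != 0.
Proof.
move=> w0 chi0; pose q := \prod_(s < P) (chi \Po (w ^+ s *: 'X)).
have q0 : q != 0.
  apply/prodf_neq0 => s _; rewrite comp_poly2_eq0 //.
  by rewrite size_scale ?size_polyX ?expf_neq0.
have [t t1 qt] := unit_circle_nonroot q0; exists t => // s sP.
move: qt; rewrite /q horner_prod => /prodf_neq0/(_ (Ordinal sP) isT).
by rewrite horner_comp hornerZ hornerX mulrC.
Qed.

End RootsOfUnity.

(** * The inequality in the time domain *)

Section TimeDomain.
Variable R : realType.
Local Notation C := R[i].
Local Notation toC := (real_complex R).
Local Notation Re := (@complex.Re R).

Definition energy T (u : nat -> R) : R := \sum_(t < T) u t ^+ 2.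

(** Impulse response of [1 + K G]. *)
Definition loop_impulse (K : R) (G : tf R) k : R := (k == 0%N)%:R + K * impulse G k.

(** Up to time [L] the response only depends on the first [L + 1] samples of the
    impulse response. *)
Lemma loop_response K G T (w : nat -> R) L s : (s <= L)%N ->
  trunc T w s + K * lti G (trunc T w) s =
  \sum_(k < L.+1) \sum_(r < T) loop_impulse K G k * w r * (s == k + r)%N%:R.
Proof.
move=> sL.
have inner k : \sum_(r < T) loop_impulse K G k * w r * (s == k + r)%N%:R =
    if (k < s.+1)%N then loop_impulse K G k * trunc T w (s - k)%N else 0.
  case: ltnP => [ks|sk]; last first.
    rewrite big1 // => r _; rewrite (_ : (_ == _) = false) ?mulr0 //.
    by apply/negbTE; rewrite neq_ltn (leq_trans sk) // leq_addr.
  rewrite /trunc; case: ltnP => [skT|Tsk].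
    rewrite (bigD1 (Ordinal skT)) //= subnKC -1?ltnS // eqxx mulr1 big1 ?addr0 // => r rsk.
    rewrite (_ : (_ == _) = false) ?mulr0 //; apply: contraNF rsk => /eqP sE.
    by apply/eqP/val_inj; rewrite /= sE addKn.
  rewrite mulr0 big1 // => r _; rewrite (_ : (_ == _) = false) ?mulr0 //.
  by apply/negbTE; rewrite eq_sym; apply: contraTneq Tsk => <-; rewrite addKn -ltnNge.
under eq_bigr => k _ do rewrite inner.
rewrite -big_mkcond -(big_ord_widen L.+1 (fun k => loop_impulse K G k * trunc T w (s - k)%N)) //.
rewrite /loop_impulse; under eq_bigr => k _ do rewrite mulrDl -mulrA.
rewrite big_split /= -mulr_sumr; congr (_ + _).
by rewrite big_ord_recl big1 ?addr0 ?mul1r ?subn0 // => k _; rewrite lift0 mul0r.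
Qed.

Variables (K : R) (G : tf R) (n : nat) (m : 'cV[R]_(n.*2.+1)) (chi : {poly C}) (eps : R).
Hypothesis stableG : RHinf G.
Hypothesis K_gt0 : 0 < K.
Hypothesis eps_gt0 : 0 < eps.
Hypothesis chi_neq0 : chi != 0.
Hypothesis freq : forall z : C, `|z| = 1 -> chi.[z] != 0 -> poly_at z (tf_den G) != 0 ->
    eps <= Re (multiplier m z * (1 + toC K * tf_at G z)).

Definition fir_loop L (z : C) : C := \sum_(k < L.+1) toC (loop_impulse K G k) / z ^+ k.

Lemma fir_frequency L0 : exists2 L, (L0 <= L)%N & forall z : C, `|z| = 1 -> chi.[z] != 0 ->
  eps / 2 <= Re (multiplier m z * fir_loop L z).
Proof.
pose mu := \sum_i `|m i 0|.
have mu_ge0 : 0 <= mu by apply: sumr_ge0.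
have Kmu1 : 0 < K * mu + 1 by rewrite ltr_wpDl // mulr_ge0 // ltW.
(* replacing G by a section within eta changes the product by at most mu K eta <= eps / 2 *)
pose eta := eps / 2 / (K * mu + 1).
have eta0 : 0 < eta by rewrite !divr_gt0.
have [L L_ge approx] := tf_series_approx stableG L0 eta0.
exists L => // z z1 chiz; have [den0] := approx z z1.
rewrite -/(tf_at G z); set GL := \sum_(k < _) _ => GL_near.
have -> : fir_loop L z = 1 + toC K * GL.
  rewrite /fir_loop /loop_impulse.
  under eq_bigr => k _ do rewrite rmorphD rmorphM mulrDl -mulrA.
  rewrite big_split /= -mulr_sumr; congr (_ + _).
  by rewrite big_ord_recl big1 ?addr0 /= ?expr0 ?invr1 ?mulr1 // => k _; rewrite mul0r.
have := freq z1 chiz den0.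
have -> : multiplier m z * (1 + toC K * tf_at G z) =
  multiplier m z * (1 + toC K * GL) + multiplier m z * (toC K * (tf_at G z - GL)) by ring.
rewrite ReD; set e := multiplier m z * (toC K * _).
suff : Re e <= eps / 2 by lra.
have mult_le : `|multiplier m z| <= toC mu.
  rewrite /mu rmorph_sum; apply: le_trans (ler_norm_sum _ _ _) _; apply: ler_sum => i _.
  by rewrite !(normrM, normfV, normrX) z1 !expr1n invr1 !mulr1 normC_real.
have e_le : `|e| <= toC (mu * (K * eta)).
  rewrite /e !normrM (rmorphM _ mu) (rmorphM _ K) /= normC_real (gtr0_norm K_gt0).
  apply: ler_pM => //; first by apply: mulr_ge0 => //; rewrite ler0c ltW.
  by apply: ler_wpM2l; rewrite ?ler0c ?(ltW K_gt0).
have : toC (Re e) <= toC (mu * (K * eta)).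
  apply: le_trans e_le; apply: le_trans (normc_ge_Re e).
  by rewrite lecR ler_norm.
rewrite lecR => /le_trans; apply.
have -> : eps / 2 = eta * (K * mu + 1) by rewrite /eta divfK // gt_eqF.
by rewrite mulrDr mulr1 [mu * _]mulrC; have := ltW eta0; lra.
Qed.

(** Parseval: with [wh] the transform of the truncated [w], the inequality in
    frequency is multiplied by [|wh|^2] and summed over [P] points.  For [P]
    larger than all exponents that occur, orthogonality retains exactly the
    terms of the two sides. *)
Lemma time_domain_inequality T (w : nat -> R) :
  eps / 2 * energy T w <=
  shift_form m T w (fun t => trunc T w t + K * lti G (trunc T w) t).
Proof.
have [L L_ge firL] := fir_frequency (T + n).
(* exponents are t + i < T + 2 n + 1 on one side, n + k + r < n + L + T + 1 on the other *)
pose P := (T + (n + n) + L + n).+1.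
have [om omP] := primitive_root_exists R[i] (ltn0Sn (T + (n + n) + L + n)); rewrite -/P in omP.
have om0 : om != 0 by rewrite -normr_eq0 (prim_root_norm omP) oner_eq0.
have [th th1 thP] := avoiding_twist P om0 chi_neq0.
have th0 : th != 0 by rewrite -normr_eq0 th1 oner_eq0.
pose pt (s : 'I_P) := th * om ^+ s.
have pt1 s : `|pt s| = 1 by rewrite normrM normrX (prim_root_norm omP) expr1n th1 mulr1.
have pt0 s : pt s != 0 by rewrite -normr_eq0 pt1 oner_eq0.
pose wh (z : C) := \sum_(t < T) toC (w t) / z ^+ t.
pose whc (z : C) := \sum_(t < T) toC (w t) * z ^+ t.
have whcE s : whc (pt s) = conjc (wh (pt s)).
  rewrite /wh rmorph_sum; apply: eq_bigr => t _.
  rewrite [RHS]rmorphM [X in _ = X * _]conjc_real [X in _ = _ * X]conjc_inv.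
  by rewrite [(pt s ^+ t)^*%C]rmorphXn /= (unit_conj (pt1 s)) exprVn invrK.
have wh2 s : whc (pt s) * wh (pt s) = `|wh (pt s)| ^+ 2.
  by rewrite whcE mulrC sqr_normc.
have PC : P%:R = toC P%:R by rewrite rmorph_nat.
have dft a b : (a < P)%N -> (b < P)%N -> \sum_s pt s ^+ a / pt s ^+ b = toC (P%:R * (a == b)%:R).
  by move=> aP bP; rewrite (twisted_dft omP th0 aP bP) rmorphM !rmorph_nat.
have energyE : \sum_s whc (pt s) * wh (pt s) = toC (P%:R * energy T w).
  under eq_bigr => s _ do rewrite mulr_suml.
  rewrite exchange_big /= /energy mulr_sumr rmorph_sum; apply: eq_bigr => t _.
  under eq_bigr => s _ do rewrite mulr_sumr.
  rewrite exchange_big /= (bigD1 t) //= [X in _ + X]big1 ?addr0 => [|r rt].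
    rewrite (eq_bigr (fun s => toC (w t ^+ 2) * (pt s ^+ t / pt s ^+ t))).
      by rewrite -mulr_sumr dft ?eqxx /P ?mulr1 -?rmorphM 1?mulrC //; have := ltn_ord t; lia.
    by move=> s _; rewrite rmorphXn /=; ring.
  rewrite (eq_bigr (fun s => toC (w t * w r) * (pt s ^+ t / pt s ^+ r))).
    rewrite -mulr_sumr dft; try by rewrite /P; have := ltn_ord t; have := ltn_ord r; lia.
    by rewrite eq_sym (inj_eq val_inj) (negbTE rt) mulr0 rmorph0 mulr0.
  by move=> s _; rewrite rmorphM /=; ring.
have BilE : \sum_s multiplier m (pt s) * (whc (pt s) * (fir_loop L (pt s) * wh (pt s))) =
    toC (P%:R * shift_form m T w (fun t => trunc T w t + K * lti G (trunc T w) t)).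
  rewrite /shift_form mulr_sumr rmorph_sum /multiplier.
  under eq_bigr => s _ do rewrite mulr_suml.
  rewrite exchange_big; apply: eq_bigr => i _ /=.
  have i_le : (i < (n + n).+1)%N by rewrite addnn.
  rewrite mulrCA mulr_sumr rmorphM rmorph_sum /= mulr_sumr.
  under eq_bigr => s _ do rewrite /whc mulr_suml mulr_sumr.
  rewrite exchange_big; apply: eq_bigr => t _ /=.
  have t_lt : (t < T)%N by [].
  have -> : tshift n i (fun t => trunc T w t + K * lti G (trunc T w) t) t =
      \sum_(k < L.+1) \sum_(r < T) loop_impulse K G k * w r * (t + i == n + k + r)%N%:R.
    rewrite /tshift; case: leqP => [n_le|lt_n].
      rewrite (@loop_response _ _ _ _ L); last by lia.
      apply: eq_bigr => k _; apply: eq_bigr => r _; congr (_ * _%:R).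
      by congr nat_of_bool; lia.
    rewrite big1 // => k _; rewrite big1 // => r _.
    by rewrite (_ : (_ == _) = false) ?mulr0 //; lia.
  rewrite !mulr_sumr rmorph_sum /= mulr_sumr.
  under eq_bigr => s _ do rewrite /fir_loop mulr_suml !mulr_sumr.
  rewrite exchange_big; apply: eq_bigr => k _ /=.
  have k_lt : (k < L.+1)%N by [].
  rewrite !mulr_sumr rmorph_sum /= mulr_sumr.
  under eq_bigr => s _ do rewrite /wh !mulr_sumr.
  rewrite exchange_big; apply: eq_bigr => r _ /=.
  have r_lt : (r < T)%N by [].
  rewrite (eq_bigr (fun s => toC (m i 0 * (w t * (loop_impulse K G k * w r)))
             * (pt s ^+ (t + i) / pt s ^+ (n + k + r)))); last first.
    move=> s _; rewrite !rmorphM /= !exprD; field.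
    by rewrite !expf_neq0.
  rewrite -mulr_sumr dft; try by rewrite /P; lia.
  by rewrite -!rmorphM /=; congr toC; ring.
have P0 : (0 : R) < P%:R by rewrite ltr0n.
rewrite -(ler_pM2l P0) mulrCA.
have -> : P%:R * energy T w = Re (\sum_s whc (pt s) * wh (pt s)) by rewrite energyE.
have -> : P%:R * shift_form m T w (fun t => trunc T w t + K * lti G (trunc T w) t) =
  Re (\sum_s multiplier m (pt s) * (whc (pt s) * (fir_loop L (pt s) * wh (pt s)))).
  by rewrite BilE.
rewrite !Re_sum mulr_sumr; apply: ler_sum => s _.
have -> : multiplier m (pt s) * (whc (pt s) * (fir_loop L (pt s) * wh (pt s)))
  = (whc (pt s) * wh (pt s)) * (multiplier m (pt s) * fir_loop L (pt s)) by ring.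
have -> : whc (pt s) * wh (pt s) = toC (Re (whc (pt s) * wh (pt s))).
  by rewrite RRe_real // wh2 ger0_real // exprn_ge0.
rewrite ReZ mulrC; apply: ler_wpM2l; last by apply: firL => //; apply: thP.
by rewrite wh2 -add_Re2_Im2 /= addr_ge0 // sqr_ge0.
Qed.

End TimeDomain.

(** * Energies of truncated signals *)

Section Energy.
Variable R : realType.
Implicit Types (u v a b : nat -> R).

Lemma energy_ge0 T u : 0 <= energy T u.
Proof. by apply: sumr_ge0 => t _; apply: sqr_ge0. Qed.

Lemma energy_eq T u v : (forall t, (t < T)%N -> u t = v t) -> energy T u = energy T v.
Proof. by move=> uv; apply: eq_bigr => t _; rewrite uv. Qed.

Lemma energy_le T u v : (forall t, (t < T)%N -> `|u t| <= `|v t|) -> energy T u <= energy T v.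
Proof.
move=> uv; apply: ler_sum => t _.
by rewrite -(real_normK (num_real (u t))) -(real_normK (num_real (v t))) ler_sqr ?nnegrE // uv.
Qed.

Lemma energy_split T T' u :
  energy (T + T') u = energy T u + \sum_(t < T') u (T + t)%N ^+ 2.
Proof. exact: big_split_ord. Qed.

Lemma energy_mono T T' u : (T <= T')%N -> energy T u <= energy T' u.
Proof.
move=> TT'; rewrite -(subnKC TT') energy_split lerDl.
by apply: sumr_ge0 => t _; apply: sqr_ge0.
Qed.

Lemma energyZ T c u : energy T (fun t => c * u t) = c ^+ 2 * energy T u.
Proof. by rewrite mulr_sumr; apply: eq_bigr => t _; rewrite exprMn. Qed.

Lemma energyD T u v : energy T (fun t => u t + v t) <= 2 * energy T u + 2 * energy T v.
Proof.
rewrite !mulr_sumr -big_split; apply: ler_sum => t _ /=.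
by have := sqr_ge0 (u t - v t); nra.
Qed.

Lemma energyB T u v : energy T (fun t => u t - v t) <= 2 * energy T u + 2 * energy T v.
Proof.
rewrite !mulr_sumr -big_split; apply: ler_sum => t _ /=.
by have := sqr_ge0 (u t + v t); nra.
Qed.

Lemma energy_trunc T T' u : (T <= T')%N -> energy T' (trunc T u) = energy T u.
Proof.
move=> TT'; rewrite -(subnKC TT') energy_split [X in _ + X]big1 ?addr0.
  by apply: energy_eq => t tT; rewrite /trunc tT.
by move=> t _; rewrite /trunc ltnNge leq_addr expr0n.
Qed.

Lemma energy_trunc_le T T' u : energy T' (trunc T u) <= energy T u.
Proof.
apply: le_trans (energy_mono _ (leq_maxl T' T)) _.
by rewrite energy_trunc ?leq_maxr.
Qed.

Lemma energy_tshift n i T u : (i <= n.*2)%N -> energy T (tshift n i u) <= energy (T + n) u.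
Proof.
move=> i_le.
have i_le2 : (i <= n + n)%N by rewrite addnn.
have -> : energy T (tshift n i u) = \sum_(s < T + n) \sum_(t < T | (t + i == n + s)%N) u s ^+ 2.
  rewrite (exchange_big_dep predT) //=; apply: eq_bigr => t _.
  rewrite /tshift; case: leqP => [le_n|lt_n].
    have s_lt : (t + i - n < T + n)%N by have := ltn_ord t; lia.
    rewrite (big_pred1 (Ordinal s_lt)) // => s /=.
    by rewrite -val_eqE /=; lia.
  rewrite expr0n big_pred0 // => s; lia.
apply: ler_sum => s _; rewrite sumr_const -[leRHS]mulr1n.
apply: ler_wpMn2l; first exact: sqr_ge0.
apply/card_le1_eqP => t t' /eqP h /eqP h'; apply/val_inj => /=; lia.
Qed.

(** Young's inequality shift by shift; the total weight of the coefficients is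
    less than 2, which absorbs the factor 1/2. *)
Lemma shift_form_bound n (m : 'cV[R]_(n.*2.+1)) T a b alpha : 0 < alpha ->
  \sum_(i < n.*2.+1) `|m i 0| < 2 ->
  shift_form m T a b <= alpha^-1 * energy T a + alpha * energy (T + n) b.
Proof.
move=> alpha0 m2; set E := leRHS.
have corr (i : 'I_(n.*2.+1)) : `|\sum_(t < T) a t * tshift n i b t| <= E / 2.
  have i_le : (i <= n.*2)%N by rewrite -ltnS.
  apply: le_trans (ler_norm_sum _ _ _) _.
  apply: le_trans (_ : (alpha^-1 * energy T a + alpha * energy T (tshift n i b)) / 2 <= _).
    rewrite !mulr_sumr -big_split /= mulr_suml; apply: ler_sum => t _.
    set x := a t; set y := tshift _ _ _ _; rewrite ler_pdivlMr // normrM.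
    rewrite -(real_normK (num_real x)) -(real_normK (num_real y)).
    rewrite -subr_ge0.
    have -> : alpha^-1 * `|x| ^+ 2 + alpha * `|y| ^+ 2 - `|x| * `|y| * 2
      = alpha^-1 * (`|x| - alpha * `|y|) ^+ 2 by field; rewrite gt_eqF.
    by rewrite mulr_ge0 ?sqr_ge0 // invr_ge0 ltW.
  by rewrite ler_pM2r // lerD2l ler_pM2l // energy_tshift.
have E0 : 0 <= E by rewrite addr_ge0 // mulr_ge0 ?energy_ge0 ?invr_ge0 // ltW.
apply: le_trans (_ : \sum_(i < n.*2.+1) `|m i 0| * (E / 2) <= _).
  apply: ler_sum => i _; apply: le_trans (ler_norm _) _.
  by rewrite normrM ler_wpM2l.
rewrite -mulr_suml; have := ltW m2; set mu := \sum_(i < _) _; nra.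
Qed.

Lemma shift_form_linl n (m : 'cV[R]_(n.*2.+1)) T a a' b :
  shift_form m T (fun t => a t - a' t) b = shift_form m T a b - shift_form m T a' b.
Proof.
rewrite /shift_form -sumrB; apply: eq_bigr => i _; rewrite -mulrBr -sumrB; congr (_ * _).
by apply: eq_bigr => t _; rewrite mulrBl.
Qed.

Lemma shift_form_linr n (m : 'cV[R]_(n.*2.+1)) T a b b' :
  shift_form m T a (fun t => b t + b' t) = shift_form m T a b + shift_form m T a b'.
Proof.
rewrite /shift_form -big_split; apply: eq_bigr => i _; rewrite /= -mulrDr -big_split; congr (_ * _).
by apply: eq_bigr => t _; rewrite /tshift /=; case: ifP => _; rewrite ?mulrDr ?mulr0 ?addr0.
Qed.

Lemma shift_form_eq n (m : 'cV[R]_(n.*2.+1)) T a a' b b' :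
  (forall i t, (t < T)%N -> a t * tshift n i b t = a' t * tshift n i b' t) ->
  shift_form m T a b = shift_form m T a' b'.
Proof.
move=> ab; apply: eq_bigr => i _; congr (_ * _); apply: eq_bigr => t _; exact: ab.
Qed.

Lemma weighted_cauchy_schwarz k (p y : 'I_k -> R) : (forall i, 0 <= p i) ->
  (\sum_i p i * y i) ^+ 2 <= (\sum_i p i) * \sum_i p i * y i ^+ 2.
Proof.
move=> p0; rewrite -(ler_pM2l (x := 2)) // mulr_natl [leRHS]mulr_natl !mulr2n.
rewrite [in X in _ <= X + _]mulrC expr2 !big_distrlr -!big_split /=.
apply: ler_sum => i _; rewrite -!big_split; apply: ler_sum => j _ /=.
rewrite -subr_ge0 (_ : _ - _ = p i * p j * (y i - y j) ^+ 2); last by ring.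
by rewrite mulr_ge0 ?sqr_ge0 // mulr_ge0.
Qed.

Lemma energy_delay T i u : energy T (fun t => if (i <= t)%N then u (t - i)%N else 0) <= energy T u.
Proof.
have [Ti|iT] := leqP T i.
  rewrite [leLHS]big1 ?energy_ge0 // => t _.
  by rewrite leqNgt (leq_trans (ltn_ord t) Ti) expr0n.
rewrite -{1}(subnKC (ltnW iT)) energy_split [energy i _]big1 ?add0r; last first.
  by move=> t _; rewrite (leqNgt i t) ltn_ord expr0n.
under eq_bigr => t _ do rewrite leq_addr addKn.
exact: (energy_mono u (leq_subr i T)).
Qed.

(** Young's inequality for convolutions: the gain of [G] is at most the sum of its
    impulse response. *)
Lemma energy_lti (G : tf R) H T w : 0 <= H ->
  (forall T, \sum_(k < T) `|impulse G k| <= H) ->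
  energy T (lti G w) <= H ^+ 2 * energy T w.
Proof.
move=> H0 sumH; pose dw i t := if (i <= t)%N then w (t - i)%N else 0.
have cs (t : 'I_T) : lti G w t ^+ 2 <= H * \sum_(i < T) `|impulse G i| * dw i t ^+ 2.
  pose p (i : 'I_T) := `|impulse G i|; pose y (i : 'I_T) := `|dw i t|.
  have p0 i : 0 <= p i by exact: normr_ge0.
  have le1 : `|lti G w t| <= \sum_i p i * y i.
    rewrite /lti (big_ord_widen T (fun i => impulse G i * w (t - i)%N)) // big_mkcond.
    apply: le_trans (ler_norm_sum _ _ _) _; apply: ler_sum => i _.
    by rewrite /p /y /dw ltnS; case: ifP; rewrite ?normrM ?normr0 ?mulr0.
  rewrite -(real_normK (num_real _)); apply: le_trans (_ : (\sum_i p i * y i) ^+ 2 <= _).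
    rewrite ler_sqr ?nnegrE //; apply: sumr_ge0 => i _; apply: mulr_ge0; exact: normr_ge0.
  apply: le_trans (weighted_cauchy_schwarz y p0) _.
  have -> : \sum_i p i * y i ^+ 2 = \sum_(i < T) `|impulse G i| * dw i t ^+ 2.
    by apply: eq_bigr => i _; rewrite /y real_normK ?num_real.
  apply: ler_wpM2r (sumH T).
  by apply: sumr_ge0 => i _; rewrite mulr_ge0 // sqr_ge0.
apply: le_trans (ler_sum _ (fun (t : 'I_T) _ => cs t)) _.
rewrite -mulr_sumr expr2 -mulrA ler_wpM2l // exchange_big /=.
apply: le_trans (_ : \sum_(i < T) `|impulse G i| * energy T w <= _).
  by apply: ler_sum => i _; rewrite -mulr_sumr ler_wpM2l // energy_delay.
by rewrite -mulr_suml ler_wpM2r ?energy_ge0.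
Qed.

End Energy.

(** * Existence and causality of the responses *)

(** Causal recursions have solutions: the [j]-th approximation is correct on
    [[0, j)]. *)
Lemma strong_recursion (T : Type) (x0 : T) (step : nat -> (nat -> T) -> T) :
  (forall j w w', (forall k, (k < j)%N -> w k = w' k) -> step j w = step j w') ->
  exists w, forall j, w j = step j w.
Proof.
move=> step_ext.
pose fix F j : nat -> T :=
  if j is j'.+1 then fun k => if k == j' then step j' (F j') else F j' k
  else fun=> x0.
(* F j is final on all arguments below j *)
pose w k := F k.+1 k.
have Fw j k : (k < j)%N -> F j k = w k.
  elim: j => // j IHj; rewrite ltnS leq_eqVlt => /predU1P[->//|kj] /=.
  by rewrite (ltn_eqF kj) IHj.
by exists w => j; rewrite {1}/w /= eqxx; apply: step_ext => k; apply: Fw.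
Qed.

Section Loop.
Variable R : realType.
Implicit Types (phi : R -> R) (f g v w : nat -> R) (kappa : R).

Lemma slope_lipschitz kappa phi : slope_restricted kappa phi ->
  forall x y, `|phi x - phi y| <= kappa * `|x - y|.
Proof.
move=> slope x y; have [->|xy] := eqVneq x y; first by rewrite !subrr normr0 mulr0.
have xy0 : x - y != 0 by rewrite subr_eq0.
have /andP[d0 dk] := slope x y xy.
rewrite -ler_pdivrMr ?normr_gt0 // -normfV -normrM ger0_norm //.
Qed.

(** The slopes of the map [x + a phi x] lie between 1 and [1 + a kappa]. *)
Lemma loop_map_increasing kappa phi a : slope_restricted kappa phi -> 0 < 1 + a * kappa ->
  exists2 rho, 0 < rho & forall x y, y <= x ->
    rho * (x - y) <= (x + a * phi x) - (y + a * phi y).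
Proof.
move=> slope wp; pose rho := Num.min 1 (1 + a * kappa).
exists rho; first by rewrite lt_min ltr01.
move=> x y; rewrite le_eqVlt => /predU1P[->|yx]; first by rewrite !subrr mulr0.
have xy : x != y by rewrite gt_eqF.
have xy0 : x - y != 0 by rewrite subr_eq0.
have := slope x y xy; set d := _ / _ => /andP[d0 dk].
have -> : x + a * phi x - (y + a * phi y) = (1 + a * d) * (x - y).
  have : phi x - phi y = d * (x - y) by rewrite /d divfK.
  by move: d {d0 dk} => d h; rewrite mulrDl -mulrA -h; ring.
rewrite ler_pM2r ?subr_gt0 // /rho ge_min.
have [a0|/ltW a0] := leP 0 a; first by rewrite lerDl mulr_ge0.
by apply/orP; right; rewrite lerD2l ler_wnM2l.
Qed.

Lemma loop_map_bij kappa phi a : slope_restricted kappa phi -> 0 < 1 + a * kappa ->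
  (forall b, exists x, x + a * phi x = b) /\ injective (fun x => x + a * phi x).
Proof.
move=> slope wp; have [rho rho0 incr] := loop_map_increasing slope wp.
set F := fun x => x + a * phi x.
split; last first.
  move=> x y Fxy; wlog yx : x y Fxy / y <= x.
    by move=> H; case: (leP y x) => [/H|/ltW/H h]; [apply | rewrite h].
  apply/eqP; rewrite eq_le yx andbT -subr_le0 -(pmulr_rle0 _ rho0).
  by apply: le_trans (incr _ _ yx) _; rewrite -/(F x) -/(F y) Fxy subrr.
move=> b; have contF : continuous F.
  move=> x; apply: cvgD; first exact: cvg_id.
  apply: cvgM; first exact: cvg_cst.
  apply/cvgrPdist_le => e e0.
  have k1 : 0 < `|kappa| + 1 by rewrite ltr_wpDl.
  near=> y; apply: le_trans (slope_lipschitz slope x y) _.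
  apply: le_trans (_ : (`|kappa| + 1) * `|x - y| <= _).
    by apply: ler_wpM2r => //; apply: le_trans (ler_norm _) _; rewrite lerDl.
  rewrite mulrC -ler_pdivlMr //.
  by near: y; apply: (@cvgr_dist_le _ _ _ _ _ id); [exact: cvg_id | rewrite divr_gt0].
pose r := `|b - F 0| / rho.
have r0 : 0 <= r by rewrite divr_ge0 // ltW.
have rhor : rho * r = `|b - F 0| by rewrite mulrC divfK // gt_eqF.
have Fr : b <= F r.
  have := incr r 0 r0; rewrite subr0 rhor -/(F r) -/(F 0) => h.
  by have := ler_norm (b - F 0); lra.
have FNr : F (- r) <= b.
  have := incr 0 (- r); rewrite oppr_le0 opprK add0r rhor -/(F (- r)) -/(F 0) => /(_ r0) h.
  have := ler_norm (- (b - F 0)); rewrite normrN opprB; lra.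
have [|||c _ Fc] := @IVT R F (- r) r b.
- by rewrite (le_trans _ r0) // oppr_le0.
- exact: continuous_subspaceT.
- by rewrite ge_min FNr le_max Fr orbT.
by exists c.
Unshelve. all: by end_near.
Qed.

Lemma ltiE (G : tf R) w j :
  lti G w j = impulse G 0 * w j + \sum_(i < j) impulse G i.+1 * w (j - i.+1)%N.
Proof. by rewrite /lti big_ord_recl subn0; congr (_ + _). Qed.

(** At each time the loop reduces to [v + G(oo) phi v = b] with [b] determined by the
    inputs and by the past of [w]. *)
Lemma feedback_exists kappa phi (G : tf R) f g : slope_restricted kappa phi ->
  0 < 1 + impulse G 0 * kappa -> exists v w, feedback G phi f g v w.
Proof.
move=> slope wp; have [surj _] := loop_map_bij slope wp.
have [sol solE] := choice surj.
pose b j w := f j + impulse G 0 * g j + \sum_(i < j) impulse G i.+1 * w (j - i.+1)%N.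
have [j w w' ww'|w wE] := strong_recursion (step := fun j w => g j - phi (sol (b j w))) 0.
  rewrite /b; congr (_ - phi (sol (_ + _))); apply: eq_bigr => i _; rewrite ww' //.
  by have := ltn_ord i; lia.
exists (fun j => sol (b j w)), w => j; split; last by rewrite {1}wE addrC.
rewrite ltiE wE; have := solE (b j w); set x := sol _; rewrite {1}/b => xE.
by rewrite mulrBr; lra.
Qed.

Lemma feedback_causal kappa phi (G : tf R) f g v w f' g' v' w' T :
  slope_restricted kappa phi -> 0 < 1 + impulse G 0 * kappa ->
  feedback G phi f g v w -> feedback G phi f' g' v' w' ->
  (forall t, (t < T)%N -> f t = f' t /\ g t = g' t) ->
  forall t, (t < T)%N -> v t = v' t /\ w t = w' t.
Proof.
move=> slope wp fb fb' fg; have [_ inj] := loop_map_bij slope wp.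
elim/ltn_ind => t IHt tT; have [ft gt] := fg t tT.
have [vE wE] := fb t; have [vE' wE'] := fb' t.
rewrite !ltiE in vE vE'.
have past : \sum_(i < t) impulse G i.+1 * w (t - i.+1)%N =
    \sum_(i < t) impulse G i.+1 * w' (t - i.+1)%N.
  apply: eq_bigr => i _; have i_lt := ltn_ord i.
  have lt1 : (t - i.+1 < t)%N by lia.
  by have [_ ->] := IHt _ lt1 (ltn_trans lt1 tT).
have vv : v t = v' t.
  by apply: inj => /=; rewrite wE past ft gt in vE; rewrite wE' in vE'; lra.
by split=> //; rewrite wE wE' vv gt.
Qed.

End Loop.

(** * The finite-horizon energy estimate *)

Section Stability.
Variable R : realType.
Implicit Types (phi : R -> R) (f g v w : nat -> R) (kappa : R).

Variables (K : R) (G : tf R) (n : nat) (m : 'cV[R]_(n.*2.+1)) (eps H : R).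
Hypothesis K_gt0 : 0 < K.
Hypothesis m0 : mcoef m 0 = 1.
Hypothesis m_lt2 : \sum_(i < n.*2.+1) `|m i 0| < 2.
Hypothesis eps_gt0 : 0 < eps.
Hypothesis H_ge0 : 0 <= H.
Hypothesis sumH : forall T, \sum_(k < T) `|impulse G k| <= H.
Hypothesis fdi : forall T (w : nat -> R),
  eps * energy T w <= shift_form m T w (fun t => trunc T w t + K * lti G (trunc T w) t).

Lemma lti_trunc T w t : (t < T)%N -> lti G (trunc T w) t = lti G w t.
Proof.
move=> tT; apply: eq_bigr => i _; rewrite /trunc (leq_ltn_trans _ tT) //.
by rewrite leq_subr.
Qed.

(** Shifts by at most [n] reach beyond [T] only from the last [n] samples. *)
Lemma shift_form_tail T (a b : nat -> R) :
  shift_form m T a (fun t => if (t < T)%N then 0 else b t) =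
  shift_form m T (fun t => if (t < T - n)%N then 0 else a t) (fun t => if (t < T)%N then 0 else b t).
Proof.
apply: eq_bigr => i _; congr (_ * _); apply: eq_bigr => t _ /=.
case: ifP => // tTn; rewrite mul0r /tshift; case: ifP => [nt|]; rewrite ?mulr0 //.
have i_lt : (i < (n + n).+1)%N by rewrite addnn.
by rewrite (_ : (t + i - n < T)%N) ?mulr0 //; lia.
Qed.

Lemma energy_tail T (u : nat -> R) :
  energy T (fun t => if (t < T - n)%N then 0 else u t) = energy T u - energy (T - n) u.
Proof.
have split (v : nat -> R) :
    energy T v = energy (T - n) v + \sum_(t < T - (T - n)) v (T - n + t)%N ^+ 2.
  by rewrite -[in LHS](subnKC (leq_subr n T)) energy_split.
rewrite !split [energy (T - n) (fun t => _)]big1 => [|t _].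
  rewrite [RHS]addrAC subrr; congr (_ + _).
  by apply: eq_bigr => t _; rewrite ltnNge leq_addr.
by rewrite ltn_ord expr0n.
Qed.

(** Put [s = G w_T] and [y = w_T + K s].  On [[0, T)] the signal [e = K v - u] is
    [y + r] with [r = K f - g] and [u = g - w], hence
    [0 <= <u, e_T> = <g, y_T> - <w, y_T> + <u, r_T>], while
    [eps |w|_T <= <w, y_T> + <w, tail>] where the tail is [K s] after time [T].
    Adding the two, the terms with [w] on the right that Young's inequality
    produces carry the factor [alpha], chosen so that they amount to half of the
    left-hand side. *)
Lemma energy_estimate : exists2 c, 0 < c & forall kappa phi f g v w,
  kappa <= K -> zf_class kappa m phi -> feedback G phi f g v w ->
  forall T, energy T w <= c * (energy T f + energy T g)
                          + c * (energy T w - energy (T - n) w).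
Proof.
(* S collects the multiples of alpha |w|_T: 2 + 2 K^2 H^2 from y, 2 from u, K^2 H^2 from the tail *)
pose S := 4 + 3 * K ^+ 2 * H ^+ 2.
have KH0 : 0 <= K ^+ 2 * H ^+ 2 by rewrite mulr_ge0 ?sqr_ge0.
have S_gt0 : 0 < S by rewrite /S; lra.
pose alpha := eps / (2 * S).
have alpha0 : 0 < alpha by rewrite divr_gt0 // mulr_gt0.
have ia0 : 0 < alpha^-1 by rewrite invr_gt0.
pose c := 2 / eps * (alpha^-1 * (4 + 2 * K ^+ 2) + 2 * alpha).
have K20 : 0 <= K ^+ 2 by apply: sqr_ge0.
exists c.
  apply: mulr_gt0; first exact: divr_gt0.
  by apply: addr_gt0; apply: mulr_gt0 => //; lra.
move=> kappa phi f g v w kK [phi0 slope phi_sign] fb T.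
have zfK : zf_class K m phi.
  split=> // x y xy; have /andP[-> d_le] := slope x y xy.
  by rewrite (le_trans d_le).
pose w' := trunc T w; pose s := lti G w'.
pose y t := w' t + K * s t.
pose r t := K * f t - g t.
pose tail t := if (t < T)%N then 0 else K * s t.
have uE t : phi (v t) = g t - w t by have [_ ->] := fb t; ring.
have sE t : (t < T)%N -> s t = lti G w t by move=> tT; rewrite /s lti_trunc.
have yT t : trunc T y t + tail t = y t.
  by rewrite /trunc /tail /y /w' /trunc; case: (t < T)%N => //; rewrite addr0.
have eE t : trunc T (fun t => K * v t - phi (v t)) t = trunc T y t + trunc T r t.
  rewrite /trunc; case: ifP => tT; rewrite ?addr0 // uE /y /r (sE t tT) /w' /trunc tT.
  by have [-> _] := fb t; ring.
have zf := zames_falb v T m0 m_lt2 zfK.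
have zf2 : shift_form m T (phi \o v) (trunc T (fun t => K * v t - phi (v t)))
  = shift_form m T g (trunc T y) - shift_form m T w (trunc T y) + shift_form m T (phi \o v) (trunc T r).
  rewrite (_ : trunc T _ = (fun t => trunc T y t + trunc T r t)); last exact/funext.
  rewrite shift_form_linr -shift_form_linl; congr (_ + _); apply: shift_form_eq => i t _.
  by rewrite /= uE.
have fdi2 : eps * energy T w <= shift_form m T w (trunc T y) + shift_form m T w tail.
  rewrite -shift_form_linr; apply: le_trans (fdi T w) _; rewrite le_eqVlt; apply/orP; left.
  apply/eqP/shift_form_eq => i t _; congr (_ * _); rewrite /tshift; case: ifP => //.
set W := energy T w in fdi2 *; set F := energy T f; set Gn := energy T g.
set Dl := W - energy (T - n) w.
have s_le T' : energy T' s <= H ^+ 2 * W.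
  apply: le_trans (energy_lti _ _ H_ge0 sumH) _.
  by rewrite ler_wpM2l ?sqr_ge0 // energy_trunc_le.
have Ty_le : energy (T + n) (trunc T y) <= 2 * W + 2 * (K ^+ 2 * (H ^+ 2 * W)).
  rewrite energy_trunc ?leq_addr //; apply: le_trans (energyD _ _ _) _.
  rewrite energyZ /w' energy_trunc // lerD2l ler_pM2l // ler_wpM2l //.
have tail_le : energy (T + n) tail <= K ^+ 2 * (H ^+ 2 * W).
  apply: le_trans (_ : energy (T + n) (fun t => K * s t) <= _).
    by apply: energy_le => t _; rewrite /tail; case: ifP; rewrite ?normr0.
  by rewrite energyZ ler_wpM2l.
have u_le : energy T (phi \o v) <= 2 * Gn + 2 * W.
  apply: le_trans (energyB _ _ _); rewrite le_eqVlt; apply/orP; left; apply/eqP.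
  by apply: energy_eq => t _; rewrite /= uE.
have r_le : energy (T + n) (trunc T r) <= 2 * (K ^+ 2 * F) + 2 * Gn.
  rewrite energy_trunc ?leq_addr //; apply: le_trans (energyB _ _ _) _.
  by rewrite energyZ.
have b1 := shift_form_bound T g (trunc T y) alpha0 m_lt2; rewrite -/Gn in b1.
have b2 := shift_form_bound T (phi \o v) (trunc T r) ia0 m_lt2; rewrite invrK in b2.
have b3 : shift_form m T w tail <= alpha^-1 * Dl + alpha * energy (T + n) tail.
  by rewrite /tail shift_form_tail /Dl /W -energy_tail; apply: shift_form_bound.
have F0 : 0 <= F by apply: energy_ge0.
have G0 : 0 <= Gn by apply: energy_ge0.
have D0 : 0 <= Dl by rewrite subr_ge0 /W; apply/energy_mono/leq_subr.
have W0 : 0 <= W by apply: energy_ge0.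
have c1 : alpha * energy (T + n) (trunc T y) <= alpha * (2 * W + 2 * (K ^+ 2 * (H ^+ 2 * W))).
  by rewrite ler_pM2l.
have c2 : alpha * energy T (phi \o v) <= alpha * (2 * Gn + 2 * W) by rewrite ler_pM2l.
have c3 : alpha^-1 * energy (T + n) (trunc T r) <= alpha^-1 * (2 * (K ^+ 2 * F) + 2 * Gn).
  by rewrite ler_pM2l.
have c4 : alpha * energy (T + n) tail <= alpha * (K ^+ 2 * (H ^+ 2 * W)) by rewrite ler_pM2l.
have aS : alpha * W * S = eps / 2 * W by rewrite /alpha; field; rewrite gt_eqF.
have halfW : eps / 2 * W <=
    alpha^-1 * (3 * Gn + 2 * (K ^+ 2 * F) + Dl) + 2 * alpha * Gn.
  have -> : eps / 2 * W = eps * W - alpha * W * S by rewrite aS; field.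
  rewrite /S; move: zf; rewrite zf2; lra.
have : W <= 2 / eps * (alpha^-1 * (3 * Gn + 2 * (K ^+ 2 * F) + Dl) + 2 * alpha * Gn).
  rewrite (_ : W = 2 / eps * (eps / 2 * W)); last by field; rewrite gt_eqF.
  by rewrite ler_pM2l // divr_gt0.
move/le_trans; apply; rewrite -mulrDr /c -[leRHS]mulrA ler_pM2l ?divr_gt0 // [leRHS]mulrDl.
apply: lerD.
  rewrite -[leRHS]mulrA. rewrite (ler_pM2l ia0); nra.
rewrite ler_pM2l; last by apply: mulr_gt0.
by rewrite addrAC lerDr addr_ge0.
Qed.

End Stability.

(** * Homotopy over the sector *)

Section Homotopy.
Variable R : realType.
Implicit Types (phi : R -> R) (f g v w : nat -> R) (kappa : R).

Variables (K : R) (G : tf R) (n : nat) (m : 'cV[R]_(n.*2.+1)) (H c : R).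
Hypothesis K_gt0 : 0 < K.
Hypothesis H_ge0 : 0 <= H.
Hypothesis sumH : forall T, \sum_(k < T) `|impulse G k| <= H.
Hypothesis c_gt0 : 0 < c.
Hypothesis estimate : forall kappa phi f g v w,
  kappa <= K -> zf_class kappa m phi -> feedback G phi f g v w ->
  forall T, energy T w <= c * (energy T f + energy T g)
                          + c * (energy T w - energy (T - n) w).

Local Notation h0 := (impulse G 0).

Definition finite_gain kappa d := forall phi f g v w,
  zf_class kappa m phi -> feedback G phi f g v w ->
  forall T, energy T w <= d * (energy T f + energy T g).

Definition sector_stable kappa := 0 < 1 + h0 * kappa /\ exists d, finite_gain kappa d.

(** Otherwise the energy would grow by [delta] every [n] steps. *)
Lemma slow_window (w : nat -> R) Bd T delta : (forall T, energy T w <= Bd) -> 0 < delta ->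
  exists2 T', (T <= T')%N & energy T' w - energy (T' - n) w <= delta.
Proof.
move=> w_le delta0.
pose a k := energy (T + k.+1 * n) w - energy (T + k * n) w.
have a_ge0 k : 0 <= a k by rewrite subr_ge0 energy_mono // leq_add2l leq_mul.
have a_sum T' : \sum_(k < T') a k <= Bd.
  have -> : \sum_(k < T') a k = energy (T + T' * n) w - energy (T + 0 * n) w.
    elim: T' => [|T' IH]; first by rewrite big_ord0 subrr.
    by rewrite big_ord_recr /= IH /a; ring.
  by rewrite lerBlDr; apply: le_trans (w_le _) _; rewrite lerDl energy_ge0.
have [L _ aL] := summable_small a_ge0 a_sum 0 delta0.
exists (T + L.+1 * n)%N; first exact: leq_addr.
by rewrite (_ : (T + L.+1 * n - n = T + L * n)%N) //; lia.
Qed.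

Lemma bounded_estimate kappa phi f g v w E Bd : kappa <= K -> zf_class kappa m phi ->
  feedback G phi f g v w -> (forall T, energy T f + energy T g <= E) ->
  (forall T, energy T w <= Bd) -> forall T, energy T w <= c * E.
Proof.
move=> kK zf fb fgE wB T; rewrite leNgt; apply/negP => lt_w.
pose delta := (energy T w - c * E) / (2 * c).
have delta0 : 0 < delta by rewrite divr_gt0 ?subr_gt0 ?mulr_gt0.
have [T' TT' win] := slow_window T wB delta0.
have e1 := energy_mono w TT'.
have e2 := estimate kK zf fb T'.
have e3 : c * (energy T' f + energy T' g) <= c * E by rewrite ler_pM2l.
have e4 : c * (energy T' w - energy (T' - n) w) <= c * delta by rewrite ler_pM2l.
have e5 : c * delta = (energy T w - c * E) / 2 by rewrite /delta; field; rewrite gt_eqF.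
lra.
Qed.

(** By causality the inputs may be truncated to [[0, T)]; the energy of the
    response is then bounded for all times, so that [bounded_estimate] applies and
    replaces the gain [d] by [c]. *)
Lemma uniform_gain kappa : kappa <= K -> sector_stable kappa -> finite_gain kappa c.
Proof.
move=> kK [wp [d gain]] phi f g v w zf fb T; have [_ slope _] := zf.
have [v' [w' fb']] := feedback_exists (trunc T f) (trunc T g) slope wp.
have fgE T' : energy T' (trunc T f) + energy T' (trunc T g) <= energy T f + energy T g.
  by rewrite lerD // energy_trunc_le.
have wB T' : energy T' w' <= `|d| * (energy T f + energy T g).
  apply: le_trans (gain _ _ _ _ _ zf fb' T') _.
  apply: le_trans (_ : `|d| * (energy T' (trunc T f) + energy T' (trunc T g)) <= _).
    by rewrite ler_wpM2r ?addr_ge0 ?energy_ge0 // ler_norm.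
  by rewrite ler_wpM2l.
rewrite (@energy_eq _ T w w'); last first.
  move=> t tT; have [|//] := feedback_causal (T := T) slope wp fb fb' _ tT.
  by move=> s sT; rewrite /trunc sT.
exact: bounded_estimate kK zf fb' fgE wB T.
Qed.

Lemma linear_zf_class kappa : 0 <= kappa -> zf_class kappa m (fun x => kappa * x).
Proof.
move=> k0; split; [by rewrite mulr0 | | by right=> x; rewrite mulrN].
move=> x y xy; rewrite -mulrBr mulfK ?subr_eq0 //.
by rewrite k0 lexx.
Qed.

(** The gain [c] applied to the linear nonlinearity [kappa x], with input [g] a
    unit pulse and at time 0, where the response is [1 / (1 + h0 kappa)]. *)
Lemma well_posed_margin kappa : 0 <= kappa -> kappa <= K -> sector_stable kappa ->
  1 <= (c + 1) * (1 + h0 * kappa).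
Proof.
move=> k0 kK st; have [wp _] := st; have zf := linear_zf_class k0.
have [_ slope _] := zf.
have [v [w fb]] := feedback_exists (fun=> 0) (fun t => (t == 0%N)%:R) slope wp.
have := uniform_gain kK st zf fb 1.
rewrite /energy !big_ord1 expr0n add0r expr1n mulr1 => w_le.
have [vE wE] := fb 0%N; rewrite ltiE big_ord0 addr0 add0r in vE.
have w1 : w 0%N * (1 + h0 * kappa) = 1 by rewrite vE /= in wE; rewrite mulrDr mulr1 {1}wE; ring.
set y := 1 + h0 * kappa in wp w1 *; set w0 := w 0%N in w_le w1.
rewrite leNgt; apply/negP => lt1.
have : w0 ^+ 2 * y ^+ 2 = 1 by rewrite -exprMn w1 expr1n.
nra.
Qed.

(** A nonlinearity of the larger sector, scaled by [kappa / kappa'], belongs to the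
    smaller one; the difference, of gain at most [delta], is moved to the input
    [g]. *)
Lemma sector_step : exists2 delta, 0 < delta & forall kappa kappa',
  0 <= kappa -> kappa <= kappa' -> kappa' <= K -> kappa' <= kappa + delta ->
  sector_stable kappa -> sector_stable kappa'.
Proof.
(* large enough for both (c + 1) |h0| < E, which keeps the loop well posed, and 8 c H^2 <= E^2, which makes the perturbation a small gain *)
pose E := 3 * (c + 1) * (`|h0| + 1) * (H + 1).
have a0 : 0 <= `|h0| by [].
have E_gt0 : 0 < E by rewrite /E !mulr_gt0 // ?ltr_wpDl // ltW.
pose delta := E^-1; have delta0 : 0 < delta by rewrite invr_gt0.
have Ed : E * delta = 1 by rewrite divff // gt_eqF.
exists delta => // kappa kappa' k0 kk' k'K k'd st.
have kK := le_trans kk' k'K; have margin := well_posed_margin k0 kK st.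
have gain := uniform_gain kK st.
have k'0 := le_trans k0 kk'.
have c_pos := c_gt0; have H_pos := H_ge0.
have cq : 0 <= c * `|h0| by rewrite mulr_ge0 // ltW.
have cH : 0 <= c * H by rewrite mulr_ge0 // ltW.
have qH : 0 <= `|h0| * H by rewrite mulr_ge0.
have cqH : 0 <= c * `|h0| * H by rewrite mulr_ge0.
have hd : (c + 1) * (`|h0| * delta) < 1.
  rewrite -[ltRHS]Ed /E mulrA ltr_pM2r //.
  by lra.
have Hd : 8 * c * (delta ^+ 2 * H ^+ 2) <= 1.
  have e1 : delta * (3 * ((c + 1) * (H + 1))) <= 1.
    by rewrite -[leRHS]Ed mulrC ler_pM2r // /E; lra.
  have e1_ge0 : 0 <= delta * (3 * ((c + 1) * (H + 1))).
    by rewrite mulr_ge0 ?(ltW delta0) //; lra.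
  apply: le_trans (exprn_ile1 2 e1_ge0 e1).
  have -> : (delta * (3 * ((c + 1) * (H + 1)))) ^+ 2 =
      9 * ((c + 1) ^+ 2 * ((H + 1) ^+ 2 * delta ^+ 2)) by ring.
  have -> : 8 * c * (delta ^+ 2 * H ^+ 2) = 8 * (c * (H ^+ 2 * delta ^+ 2)) by ring.
  have c2 : 0 <= c ^+ 2 by apply: sqr_ge0.
  have d2 : 0 <= delta ^+ 2 by apply: sqr_ge0.
  have H2 : 0 <= H ^+ 2 by apply: sqr_ge0.
  have le1 : H ^+ 2 * delta ^+ 2 <= (H + 1) ^+ 2 * delta ^+ 2.
    by apply: ler_wpM2r => //; lra.
  have le0 : 0 <= H ^+ 2 * delta ^+ 2 by apply: mulr_ge0.
  apply: le_trans (_ : 9 * (c * (H ^+ 2 * delta ^+ 2)) <= _).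
    by apply: ler_wpM2r; [rewrite mulr_ge0 // ltW | lra].
  by rewrite ler_pM2l //; apply: ler_pM => //; lra.
have [<-//|kk'ne] := eqVneq kappa kappa'.
have k'_gt0 : 0 < kappa' by apply: le_lt_trans k0 _; rewrite lt_neqAle kk'ne.
split.
  have : - (`|h0| * delta) <= h0 * (kappa' - kappa).
    apply: le_trans (_ : - (`|h0| * (kappa' - kappa)) <= _).
      by rewrite lerN2 ler_wpM2l // lerBlDl.
    by rewrite -mulNr ler_wpM2r ?subr_ge0 // lerNl -normrN ler_norm.
  nra.
exists (4 * c * (1 + 2 * delta ^+ 2)) => phi f g v w [phi0 slope sign] fb T.
pose rho := kappa / kappa'.
have rho0 : 0 <= rho by rewrite divr_ge0.
have rho1 : rho <= 1 by rewrite ler_pdivrMr // mul1r.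
have rhok' : rho * kappa' = kappa by rewrite divfK // gt_eqF.
pose phi1 x := rho * phi x.
have zf1 : zf_class kappa m phi1.
  split; first by rewrite /phi1 phi0 mulr0.
    move=> x y xy; have /andP[d_ge d_le] := slope x y xy.
    by rewrite /phi1 -mulrBr -mulrA mulr_ge0 //= -rhok' ler_wpM2l.
  by case: sign => [|odd]; [left | right=> x; rewrite /phi1 odd mulrN].
pose e t := (1 - rho) * phi (v t).
have fb1 : feedback G phi1 f (fun t => g t - e t) v w.
  by move=> t; have [vE wE] := fb t; split=> //; rewrite wE /phi1 /e; ring.
have e_le : energy T e <= delta ^+ 2 * energy T v.
  rewrite -energyZ; apply: energy_le => t _; rewrite /e !normrM.
  have := slope_lipschitz slope (v t) 0; rewrite phi0 !subr0 => phiv.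
  apply: le_trans (ler_wpM2l (normr_ge0 _) phiv) _.
  rewrite mulrA ler_wpM2r //.
  have -> : `|1 - rho| = 1 - rho by rewrite ger0_norm // subr_ge0.
  by rewrite (gtr0_norm delta0) mulrBl mul1r rhok' lerBlDl.
have v_le : energy T v <= 2 * energy T f + 2 * (H ^+ 2 * energy T w).
  rewrite (@energy_eq _ T v (fun t => f t + lti G w t)); last by move=> t _; have [] := fb t.
  by apply: le_trans (energyD _ _ _) _; rewrite lerD2l ler_pM2l // energy_lti.
have g_le := energyB T g e.
have := gain _ _ _ _ _ zf1 fb1 T.
set W := energy T w in v_le *; set F := energy T f in v_le *; set Gn := energy T g in g_le *.
set V := energy T v in e_le v_le; set Ee := energy T e in e_le g_le.
set G1 := energy T _ in g_le *; move=> w_le.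
have F0 : 0 <= F by apply: energy_ge0.
have G0 : 0 <= Gn by apply: energy_ge0.
have W0 : 0 <= W by apply: energy_ge0.
have d20 : 0 <= delta ^+ 2 by apply: sqr_ge0.
have V2 : delta ^+ 2 * V <= delta ^+ 2 * (2 * F + 2 * (H ^+ 2 * W)) by rewrite ler_wpM2l.
have : W <= c * (F + 2 * Gn + 2 * (delta ^+ 2 * (2 * F + 2 * (H ^+ 2 * W)))).
  by apply: le_trans w_le _; rewrite ler_pM2l //; lra.
have : 8 * c * (delta ^+ 2 * H ^+ 2) * W <= W by rewrite -[leRHS]mul1r ler_wpM2r.
have : 0 <= c * (delta ^+ 2 * Gn) by rewrite !mulr_ge0 // ltW.
have : 0 <= c * F by rewrite mulr_ge0 // ltW.
lra.
Qed.

Lemma sector_homotopy : sector_stable K.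
Proof.
have [delta delta0 step] := sector_step.
have st k : sector_stable (Num.min (k%:R * delta) K).
  elim: k => [|k IHk].
    rewrite mul0r (min_l (ltW K_gt0)); split; first by rewrite mulr0 addr0 ltr01.
    exists 1 => phi f g v w [phi0 slope _] fb T.
    have phiE x : phi x = 0.
      by have := slope_lipschitz slope x 0; rewrite phi0 !subr0 mul0r normr_le0 => /eqP.
    rewrite mul1r (@energy_eq _ T w g) ?lerDr ?energy_ge0 // => t _.
    by have [_ ->] := fb t; rewrite phiE oppr0 add0r.
  have mono : k%:R * delta <= k.+1%:R * delta by rewrite ler_pM2r // ler_nat.
  have kd0 : 0 <= k%:R * delta by rewrite mulr_ge0 // ltW.
  have kS : k.+1%:R * delta = k%:R * delta + delta by rewrite -natr1 mulrDl mul1r.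
  apply: step IHk.
  - by rewrite le_min kd0 ltW.
  - by rewrite le_min !ge_min mono lexx orbT.
  - by rewrite ge_min lexx orbT.
  - by rewrite addr_minl le_min !ge_min kS lexx lerDl (ltW delta0) orbT.
have [k kK] : exists k : nat, K <= k%:R * delta.
  exists (Num.bound (K / delta)); rewrite -ler_pdivrMr // ltW //.
  by apply: archi_boundP; rewrite divr_ge0 // ltW.
by have := st k; rewrite min_r.
Qed.

End Homotopy.

(** * Stability of the loop *)

(** Partial sums of squares are monotone, so summability is boundedness. *)
Lemma ell2_bounded (R : realType) (u : nat -> R) :
  ell2 u <-> exists B, forall T, energy T u <= B.
Proof.
have serE T : series (fun j => u j ^+ 2) T = energy T u by rewrite /series /= big_mkord.
have mono : nondecreasing_seq (series (fun j => u j ^+ 2)).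
  by move=> S T ST; rewrite !serE; apply: energy_mono.
split=> [cu|[B uB]].
  by exists (limn (series (fun j => u j ^+ 2))) => T; rewrite -serE; apply: nondecreasing_cvgn_le.
apply: nondecreasing_is_cvgn => //; exists B => _ [T _ <-].
by rewrite serE.
Qed.

Theorem mainTheorem2 (R : realType) (K : R) (G : tf R) (phi : R -> R)
    (n N : nat) (A : 'M[R]_N) (B : 'M[R]_(N, 1))
    (C : 'M[R]_(n.+1 + n.+1, N)) (D : 'M[R]_(n.+1 + n.+1, 1))
    (X : 'M[R]_N) (m : 'cV[R]_(n.*2.+1)) :
  0 < K ->
  RHinf G ->
  phi 0 = 0 ->
  slope_restricted K phi ->
  state_space (Psi R n *m col_mx (- G)%:M 1%:M) A B C D ->
  X^T = X ->
  mcoef m 0 = 1 ->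
  neg_def
    (block_mx (A^T *m X *m A - X) (A^T *m X *m B)
              (B^T *m X *m A) (B^T *m X *m B)
     + (row_mx C D)^T *m kappa K m *m row_mx C D) ->
  \sum_(i < n.*2.+1) `|m i 0| < 2 ->
  (forall i : int, `|i| <= n%:Z -> i != 0 -> mcoef m i <= 0) \/ odd_fun phi ->
  ell2_stable G phi.
Proof.
move=> K_gt0 G_stable phi0 slope ss X_sym m0 lmi m_lt2 phi_sign.
have [eps eps0 freq] := frequency_inequality ss lmi.
have chi0 : map_poly (real_complex R) (char_poly A) != 0.
  by rewrite map_poly_eq0 monic_neq0 // char_poly_monic.
have fdi := time_domain_inequality G_stable K_gt0 eps0 chi0 freq.
have [H H_ge0 sumH] := impulse_summable G_stable.
have eps2 : 0 < eps / 2 by rewrite divr_gt0.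
have [c c_gt0 est] := energy_estimate K_gt0 m0 m_lt2 eps2 H_ge0 sumH fdi.
have [wp [d gain]] := sector_homotopy K_gt0 H_ge0 sumH c_gt0 est.
have zf : zf_class K m phi by [].
move=> f g /ell2_bounded[Bf f_le] /ell2_bounded[Bg g_le]; split.
  exact: feedback_exists slope wp.
move=> v w fb.
have w_le T : energy T w <= `|d| * (Bf + Bg).
  apply: le_trans (gain _ _ _ _ _ zf fb T) _.
  apply: le_trans (_ : `|d| * (energy T f + energy T g) <= _).
    by rewrite ler_wpM2r ?addr_ge0 ?energy_ge0 // ler_norm.
  by rewrite ler_wpM2l // lerD.
split; apply/ell2_bounded; last by eexists.
exists (2 * Bf + 2 * (H ^+ 2 * (`|d| * (Bf + Bg)))) => T.
rewrite (@energy_eq _ T v (fun t => f t + lti G w t)); last by move=> t _; have [] := fb t.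
apply: le_trans (energyD _ _ _) _; rewrite lerD ?ler_pM2l //.
apply: le_trans (energy_lti _ _ H_ge0 sumH) _.
by rewrite ler_wpM2l ?sqr_ge0.
Qed.
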